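(* Let $(\varphi_{s,t})_{0\le s\le t<+\infty}$ be a family of holomorphic maps $\varphi_{s,t}:\mathbb{D}\to\mathbb{D}$ such that: \begin{itemize} \item $\varphi_{s,s}=\mathrm{id}_{\mathbb{D}}$ for all $s\ge0$; \item $\varphi_{s,t}=\varphi_{u,t}\circ\varphi_{s,u}$ whenever $0\le s\le u\le t<+\infty$; \item $\varphi_{s,t}\in\mathcal{A}(\mathbb{D})$ for all $0\le s\le t<+\infty$; \item for each $z\in\mathbb{D}$ the mapping $(s,t)\mapsto\varphi_{s,t}(z)$ from $\{(s,t)\in\mathbb{R}^2:0\le s\le t\}$ to $\mathbb{D}$ is separately continuous in $s$ and in $t$; \item none of the functions $\varphi_{s,t}$ is constant. \end{itemize} Then for each $s\ge0$ the mapping $[s,+\infty)\ni t\mapsto\varphi_{s,t}\in\mathcal{A}(\mathbb{D})$ is continuous.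
   Context: $\mathbb{D}=\{z\in\mathbb{C}:|z|<1\}$. $\mathcal{A}(\mathbb{D})$ denotes the class of all holomorphic functions in $\mathbb{D}$ admitting a continuous extension to the closed unit disk $\overline{\mathbb{D}}$, endowed with the supremum norm $\|\varphi\|_{\mathcal{A}(\mathbb{D})}:=\sup_{z\in\mathbb{D}}|\varphi(z)|$. *)

(* Defs.v *)
From Stdlib Require Import Reals.
From Coquelicot Require Import Coquelicot.
Open Scope R_scope.

(* Functions on the unit disk are represented by total functions [C -> C];
   every notion below depends only on their values on the open disk. *)

Definition disk (z : C) : Prop := Cmod z < 1.

Definition closed_disk (z : C) : Prop := Cmod z <= 1.

Definition holomorphic_on_disk (f : C -> C) : Prop :=
  forall z : C, disk z -> @ex_derive C_AbsRing C_NormedModule f z.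

(* Membership in the disk algebra.  The extension [g] is a separate function
   because the values of [f] outside the open disk are irrelevant. *)
Definition disk_algebra (f : C -> C) : Prop :=
  holomorphic_on_disk f /\
  exists g : C -> C,
    continuous_on closed_disk g /\ (forall z : C, disk z -> g z = f z).

(* Supremum norm over the open disk, valued in [Rbar] so that no junk value
   is taken when [f] is unbounded. *)
Definition disk_norm (f : C -> C) : Rbar :=
  Lub_Rbar (fun r : R => exists z : C, disk z /\ r = Cmod (f z)).

(* [F], restricted to [I], is a continuous map from [I] to the disk algebra
   with its supremum norm. *)
Definition continuous_on_to_disk_algebra (I : R -> Prop) (F : R -> C -> C)
    : Prop :=
  (forall t : R, I t -> disk_algebra (F t)) /\
  forall t0 : R, I t0 ->
    forall eps : posreal,
      within I (locally t0)
        (fun t : R =>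
           Rbar_lt (disk_norm (fun z : C => (F t z - F t0 z)%C)) eps).

Definition constant_on_disk (f : C -> C) : Prop :=
  exists c : C, forall z : C, disk z -> f z = c.

(* Main.v *)
Require Import Defs.
From Stdlib Require Import Reals Lra Lia Classical ClassicalEpsilon.
From Coquelicot Require Import Coquelicot.
Open Scope R_scope.

(** Suppose that [t |-> phi s t] is not continuous at [t0] for the supremum norm.
    Then there are times [t] tending to [t0] and points [z] of the disk such that
    [phi s t z] stays away from [phi s t0 z].  Let [z] cluster at [sigma] and
    [phi s t z] at [q], let [T] be a time after [t0], and let [p] and [c] be the
    values at [sigma] of the continuous extensions of [phi s t0] and [phi s T];
    then [p <> q].  For a fixed [y] near [sigma], the image under [phi s t] of the
    segment from [y] to [z] is a path going from near [p] to near [q].  Since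
    [phi t T (phi s t w) = phi s T w], the map [phi t T] is close to [c] on this
    whole path.  By [two_constants], a bounded holomorphic function that is close
    to [c] on a path between neighbourhoods of [p] and [q] is close to [c] at each
    point [a] off the hyperbolic line through [p] and [q], however near the path is
    to the circle.  So [phi t T a] is close to [c], and [phi t0 T a = c] in
    the limit.  Such points [a] are dense ([seen_at_angle_dense]), hence
    [phi t0 T] would be constant.  The argument covers limits of [t] from both
    sides at once.

    For the two-constants theorem, an automorphism of the disk moves [a] to [0]
    and a part of the path joins two rays at angle [PI / k] ([angle_estimate]).
    Multiplying [f - c] by its images under the dihedral group of these rays gives
    a function [g] that is real on both rays ([sector_estimate]), and it remains to
    see that [|g 0|] is at most the maximum of [|g|] on the path
    ([maximum_principle_between_rays]).  Otherwise consider the form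
    [(g z / g 0) ^ m / z dz].  It has residue [1] at [0], so it is the logarithmic
    derivative of a function [E m] that is single valued on the disk
    ([exp_log_primitive]) and preserves the two rays.  On the path the form tends
    to [0] with growing [m], so the values of [E m] at the two ends become
    proportionally equal, although they lie on different rays.

    The construction of [E m] needs a primitive of [(1 - u z) / z] for a
    holomorphic [u] with [u 0 = 1], that is Cauchy's theorem for triangles one
    vertex of which is exceptional; it is derived from [goursat]. *)

(** * Continuity and complex differentiability *)

Lemma continuous_C_norm (U : UniformSpace) (f : U -> C) (x : U) :
  continuous f x <->
  forall eps : R, 0 < eps -> locally x (fun y => Cmod (f y - f x) < eps).
Proof.
  unfold continuous.
  rewrite (filterlim_locally_ball_norm (U := C_R_NormedModule)).
  split.
  - intros H eps Heps. generalize (H (mkposreal eps Heps)).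
    apply filter_imp. intros y Hy. unfold ball_norm in Hy.
    rewrite Cmod_norm. exact Hy.
  - intros H eps. generalize (H eps (cond_pos eps)).
    apply filter_imp. intros y Hy. unfold ball_norm.
    rewrite Cmod_norm in Hy. exact Hy.
Qed.

Lemma locally_C_norm (z : C) (P : C -> Prop) :
  locally z P <-> exists d : R, 0 < d /\ forall y, Cmod (y - z) < d -> P y.
Proof.
  split.
  - intros H.
    destruct (locally_norm_le_locally (V := C_R_NormedModule) z P H) as [d Hd].
    exists d. split; [apply cond_pos|]. intros y Hy. apply Hd.
    unfold ball_norm. rewrite Cmod_norm in Hy. exact Hy.
  - intros [d [Hd H]].
    apply (locally_le_locally_norm (V := C_R_NormedModule) z P).
    exists (mkposreal d Hd). intros y Hy. apply H. rewrite Cmod_norm. exact Hy.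
Qed.

Lemma continuous_C_C (f : C -> C) (z : C) :
  continuous f z <->
  forall eps : R, 0 < eps ->
    exists d : R, 0 < d /\
      forall y, Cmod (y - z) < d -> Cmod (f y - f z) < eps.
Proof.
  rewrite continuous_C_norm.
  split; intros H eps Heps.
  - apply locally_C_norm. now apply H.
  - apply locally_C_norm. now apply H.
Qed.

Lemma continuous_R_C (f : R -> C) (t : R) :
  continuous f t <->
  forall eps : R, 0 < eps ->
    exists d : R, 0 < d /\
      forall u, Rabs (u - t) < d -> Cmod (f u - f t) < eps.
Proof.
  rewrite continuous_C_norm.
  split; intros H eps Heps.
  - destruct (H eps Heps) as [d Hd]. exists d. split; [apply cond_pos|].
    intros u Hu. now apply Hd.
  - destruct (H eps Heps) as [d [Hd Hf]]. exists (mkposreal d Hd).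
    intros u Hu. now apply Hf.
Qed.

Lemma Cminus_diag (z : C) : (z - z)%C = 0%C.
Proof. ring. Qed.

(** Equations between complex numbers may be typed in one of the vector space
    structures of [C], where [ring] does not recognise them. *)
Ltac Cring := match goal with |- ?a = ?b => change (@eq C a b); ring end.

Lemma im_le_Cmod (c : C) : Rabs (Im c) <= Cmod c.
Proof.
  replace (Im c) with (- Re (c * Ci)%C) by (rewrite re_mult_Ci; ring).
  rewrite Rabs_Ropp. apply Rle_trans with (1 := re_le_Cmod _).
  rewrite Cmod_mult. replace (Cmod Ci) with 1; [lra|].
  unfold Cmod, Ci; simpl. replace (0 * (0 * 1) + 1 * (1 * 1)) with 1 by ring.
  now rewrite sqrt_1.
Qed.

Lemma Cmod_le_re_im (c : C) : Cmod c <= Rabs (Re c) + Rabs (Im c).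
Proof.
  unfold Cmod. destruct c as [x y]; simpl.
  rewrite <- (sqrt_Rsqr (Rabs x + Rabs y)).
  2: pose proof (Rabs_pos x); pose proof (Rabs_pos y); lra.
  apply sqrt_le_1_alt. unfold Rsqr.
  pose proof (Rabs_pos x); pose proof (Rabs_pos y).
  assert (x * x = Rabs x * Rabs x)
    by (unfold Rabs; destruct (Rcase_abs x); ring).
  assert (y * y = Rabs y * Rabs y)
    by (unfold Rabs; destruct (Rcase_abs y); ring).
  nra.
Qed.

Lemma Cmod_triangle_minus (x y : C) : Cmod (x - y) <= Cmod x + Cmod y.
Proof.
  unfold Cminus. rewrite <- (Cmod_opp y). apply Cmod_triangle.
Qed.

Lemma Cmod_minus_sym (x y : C) : Cmod (x - y) = Cmod (y - x).
Proof. rewrite <- Cmod_opp. f_equal. ring. Qed.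

Lemma Cmod_reverse_triangle (x y : C) : Cmod x - Cmod y <= Cmod (x - y).
Proof.
  pose proof (Cmod_triangle (x - y) y) as H.
  replace (x - y + y)%C with x in H by ring. lra.
Qed.

Lemma continuous_Re (U : UniformSpace) (f : U -> C) (x : U) :
  continuous f x -> continuous (fun y => Re (f y)) x.
Proof.
  intros H. apply (continuous_comp f (fun c : C => fst c)); [exact H|].
  destruct (f x). apply continuous_fst.
Qed.

Lemma continuous_Im (U : UniformSpace) (f : U -> C) (x : U) :
  continuous f x -> continuous (fun y => Im (f y)) x.
Proof.
  intros H. apply (continuous_comp f (fun c : C => snd c)); [exact H|].
  destruct (f x). apply continuous_snd.
Qed.

Lemma continuous_Re_Im (U : UniformSpace) (f : U -> C) (x : U) :
  continuous (fun y => Re (f y)) x -> continuous (fun y => Im (f y)) x ->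
  continuous f x.
Proof.
  intros H1 H2. apply filterlim_locally. intros eps.
  generalize (proj1 (filterlim_locally _ _) H1 eps)
             (proj1 (filterlim_locally _ _) H2 eps).
  intros A B. generalize (filter_and _ _ A B). apply filter_imp.
  intros y [Hy1 Hy2]. split; assumption.
Qed.

Lemma continuous_RtoC (U : UniformSpace) (f : U -> R) (x : U) :
  continuous f x -> continuous (fun y => RtoC (f y)) x.
Proof.
  intros H. apply continuous_Re_Im; [exact H|]. apply continuous_const.
Qed.

Lemma continuous_Cplus (U : UniformSpace) (f g : U -> C) (x : U) :
  continuous f x -> continuous g x -> continuous (fun y => f y + g y)%C x.
Proof. exact (@continuous_plus U _ C_R_NormedModule f g x). Qed.

Lemma continuous_Copp (U : UniformSpace) (f : U -> C) (x : U) :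
  continuous f x -> continuous (fun y => - f y)%C x.
Proof. exact (@continuous_opp U _ C_R_NormedModule f x). Qed.

Lemma continuous_Cminus (U : UniformSpace) (f g : U -> C) (x : U) :
  continuous f x -> continuous g x -> continuous (fun y => f y - g y)%C x.
Proof.
  intros; apply continuous_Cplus; [assumption|now apply continuous_Copp].
Qed.

Lemma continuous_Cmult (U : UniformSpace) (f g : U -> C) (x : U) :
  continuous f x -> continuous g x -> continuous (fun y => f y * g y)%C x.
Proof.
  intros Hf Hg.
  pose proof (continuous_Re _ _ _ Hf). pose proof (continuous_Im _ _ _ Hf).
  pose proof (continuous_Re _ _ _ Hg). pose proof (continuous_Im _ _ _ Hg).
  apply continuous_Re_Im.
  - apply continuous_ext
      with (f := fun y => Re (f y) * Re (g y) - Im (f y) * Im (g y)).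
    { intros y. now rewrite re_mult. }
    apply (continuous_minus (V := R_NormedModule));
      now apply (continuous_mult (K := R_AbsRing)).
  - apply continuous_ext
      with (f := fun y => Re (f y) * Im (g y) + Im (f y) * Re (g y)).
    { intros y. now rewrite im_mult. }
    apply (continuous_plus (V := R_NormedModule));
      now apply (continuous_mult (K := R_AbsRing)).
Qed.

Lemma continuous_Cconj (U : UniformSpace) (f : U -> C) (x : U) :
  continuous f x -> continuous (fun y => Cconj (f y)) x.
Proof.
  intros Hf. apply continuous_Re_Im; simpl.
  - now apply continuous_Re.
  - apply (continuous_opp (V := R_NormedModule)). now apply continuous_Im.
Qed.

Lemma continuous_Cmod (U : UniformSpace) (f : U -> C) (x : U) :
  continuous f x -> continuous (fun y => Cmod (f y)) x.
Proof.
  rewrite continuous_C_norm. intros Hf.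
  apply filterlim_locally. intros eps.
  generalize (Hf eps (cond_pos eps)). apply filter_imp. intros y Hy.
  change (Rabs (Cmod (f y) - Cmod (f x)) < eps).
  pose proof (Cmod_reverse_triangle (f y) (f x)).
  pose proof (Cmod_reverse_triangle (f x) (f y)).
  rewrite (Cmod_minus_sym (f x)) in H0.
  apply Rabs_def1; lra.
Qed.

Lemma continuous_Cinv_id (z : C) : z <> 0%C -> continuous Cinv z.
Proof.
  intros Hz. apply continuous_C_C. intros eps Heps.
  pose proof (proj1 (Cmod_gt_0 z) Hz) as Hm.
  exists (Rmin (Cmod z / 2) (eps * (Cmod z * Cmod z) / 2)). split.
  { apply Rmin_glb_lt; [lra|].
    pose proof (Rmult_lt_0_compat _ _ Hm Hm).
    pose proof (Rmult_lt_0_compat _ _ Heps H). lra. }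
  intros y Hy.
  pose proof (Rmin_l (Cmod z / 2) (eps * (Cmod z * Cmod z) / 2)).
  pose proof (Rmin_r (Cmod z / 2) (eps * (Cmod z * Cmod z) / 2)).
  pose proof (Cmod_reverse_triangle z y). rewrite Cmod_minus_sym in H1.
  assert (Hy0 : 0 < Cmod y) by lra.
  assert (y <> 0%C) by now apply Cmod_gt_0.
  replace (/ y - / z)%C with (- (y - z) * / (y * z))%C by (field; now split).
  rewrite Cmod_mult, Cmod_opp, Cmod_inv, Cmod_mult by now apply Cmult_neq_0.
  apply Rmult_lt_reg_r with (Cmod y * Cmod z); [nra|].
  rewrite Rmult_assoc, Rinv_l, Rmult_1_r by nra.
  assert (eps * (Cmod z * Cmod z) / 2 <= eps * (Cmod y * Cmod z)); [|lra].
  unfold Rdiv. rewrite Rmult_assoc. apply Rmult_le_compat_l; nra.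
Qed.

Lemma continuous_Cinv (U : UniformSpace) (f : U -> C) (x : U) :
  continuous f x -> f x <> 0%C -> continuous (fun y => / f y)%C x.
Proof.
  intros Hf H0. apply (continuous_comp f Cinv); [exact Hf|].
  now apply continuous_Cinv_id.
Qed.

(** Carathéodory's form of differentiability: the slope [q] is a function
    defined everywhere, so that the rules of calculus are algebraic identities
    between slopes. *)
Definition cderiv (f : C -> C) (z l : C) : Prop :=
  exists q : C -> C,
    q z = l /\ continuous q z /\ forall y, f y = (f z + q y * (y - z))%C.

Lemma cderiv_continuous (f : C -> C) (z l : C) :
  cderiv f z l -> continuous f z.
Proof.
  intros [q [_ [Hq Hf]]].
  apply continuous_ext with (f := fun y => (f z + q y * (y - z))%C).
  { intros y. symmetry. apply Hf. }
  apply continuous_Cplus; [apply continuous_const|].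
  apply continuous_Cmult; [exact Hq|].
  apply continuous_Cminus; [apply continuous_id|apply continuous_const].
Qed.

Lemma cderiv_eq (f : C -> C) (z l l' : C) :
  cderiv f z l -> l = l' -> cderiv f z l'.
Proof. now intros H <-. Qed.

Lemma cderiv_ext (f g : C -> C) (z l : C) :
  (forall y, f y = g y) -> cderiv f z l -> cderiv g z l.
Proof.
  intros E [q [H1 [H2 H3]]]. exists q. split; [exact H1|]. split; [exact H2|].
  intros y. now rewrite <- !E.
Qed.

Lemma cderiv_const (c z : C) : cderiv (fun _ => c) z 0%C.
Proof.
  exists (fun _ => 0%C). split; [easy|]. split; [apply continuous_const|].
  intros y. ring.
Qed.

Lemma cderiv_id (z : C) : cderiv (fun y => y) z 1%C.
Proof.
  exists (fun _ => 1%C). split; [easy|]. split; [apply continuous_const|].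
  intros y. ring.
Qed.

Lemma cderiv_plus (f g : C -> C) (z l m : C) :
  cderiv f z l -> cderiv g z m -> cderiv (fun y => f y + g y)%C z (l + m)%C.
Proof.
  intros [p [<- [Cp Hf]]] [q [<- [Cq Hg]]]. exists (fun y => p y + q y)%C.
  split; [easy|]. split; [now apply continuous_Cplus|].
  intros y. rewrite (Hf y), (Hg y). ring.
Qed.

Lemma cderiv_opp (f : C -> C) (z l : C) :
  cderiv f z l -> cderiv (fun y => - f y)%C z (- l)%C.
Proof.
  intros [p [<- [Cp Hf]]]. exists (fun y => - p y)%C.
  split; [easy|]. split; [now apply continuous_Copp|].
  intros y. rewrite (Hf y). ring.
Qed.

Lemma cderiv_minus (f g : C -> C) (z l m : C) :
  cderiv f z l -> cderiv g z m -> cderiv (fun y => f y - g y)%C z (l - m)%C.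
Proof. intros. apply cderiv_plus; [assumption|now apply cderiv_opp]. Qed.

Lemma cderiv_mult (f g : C -> C) (z l m : C) :
  cderiv f z l -> cderiv g z m ->
  cderiv (fun y => f y * g y)%C z (l * g z + f z * m)%C.
Proof.
  intros Df Dg. pose proof (cderiv_continuous _ _ _ Dg) as Cg.
  destruct Df as [p [<- [Cp Hf]]]. destruct Dg as [q [<- [Cq Hg]]].
  exists (fun y => p y * g y + f z * q y)%C.
  split; [easy|]. split.
  - apply continuous_Cplus; apply continuous_Cmult; try assumption.
    apply continuous_const.
  - intros y. rewrite (Hf y). rewrite (Hg y) at 1. rewrite (Hg y). ring.
Qed.

Lemma cderiv_comp (f g : C -> C) (z l m : C) :
  cderiv f (g z) l -> cderiv g z m -> cderiv (fun y => f (g y)) z (l * m)%C.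
Proof.
  intros Df Dg. pose proof (cderiv_continuous _ _ _ Dg) as Cg.
  destruct Df as [p [<- [Cp Hf]]]. destruct Dg as [q [<- [Cq Hg]]].
  exists (fun y => p (g y) * q y)%C.
  split; [easy|]. split.
  - apply continuous_Cmult; [|assumption]. now apply (continuous_comp g p).
  - intros y. rewrite (Hf (g y)). rewrite (Hg y) at 2. ring.
Qed.

(** The characterisation by estimates only sees [f] near [z].  It is what allows
    quotients, whose slopes satisfy their algebraic identity only where the
    denominator does not vanish. *)
Lemma cderiv_intro (f : C -> C) (z l : C) :
  (forall eps : R, 0 < eps -> exists d : R, 0 < d /\
     forall y, Cmod (y - z) < d ->
       Cmod (f y - f z - l * (y - z)) <= eps * Cmod (y - z)) ->
  cderiv f z l.
Proof.
  intros H.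
  exists (fun y => if excluded_middle_informative (y = z) then l
                   else ((f y - f z) / (y - z))%C).
  split.
  { now destruct (excluded_middle_informative (z = z)). }
  split.
  - apply continuous_C_C. intros eps Heps.
    destruct (H (eps / 2)) as [d [Hd Hf]]; [lra|].
    exists d. split; [exact Hd|]. intros y Hy.
    destruct (excluded_middle_informative (z = z)) as [_|N]; [|now elim N].
    destruct (excluded_middle_informative (y = z)) as [E|N].
    + rewrite Cminus_diag. now rewrite Cmod_0.
    + assert (N' : (y - z)%C <> 0%C) by now apply Cminus_eq_contra.
      replace ((f y - f z) / (y - z) - l)%C
        with ((f y - f z - l * (y - z)) / (y - z))%C by (field; exact N').
      rewrite Cmod_div by exact N'.
      apply Cmod_gt_0 in N'. specialize (Hf y Hy).
      apply Rmult_lt_reg_r with (Cmod (y - z)); [exact N'|].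
      unfold Rdiv. rewrite Rmult_assoc, Rinv_l by lra. nra.
  - intros y.
    destruct (excluded_middle_informative (y = z)) as [->|N]; [ring|].
    field. now apply Cminus_eq_contra.
Qed.

Lemma cderiv_elim (f : C -> C) (z l : C) :
  cderiv f z l ->
  forall eps : R, 0 < eps -> exists d : R, 0 < d /\
     forall y, Cmod (y - z) < d ->
       Cmod (f y - f z - l * (y - z)) <= eps * Cmod (y - z).
Proof.
  intros [q [<- [Cq Hf]]] eps Heps.
  destruct (proj1 (continuous_C_C _ _) Cq eps Heps) as [d [Hd Hq]].
  exists d. split; [exact Hd|]. intros y Hy.
  replace (f y - f z - q z * (y - z))%C with ((q y - q z) * (y - z))%C
    by (rewrite (Hf y); ring).
  rewrite Cmod_mult. apply Rmult_le_compat_r; [apply Cmod_ge_0|].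
  left. now apply Hq.
Qed.

Lemma cderiv_ext_loc (f g : C -> C) (z l : C) (r : R) :
  0 < r -> (forall y, Cmod (y - z) < r -> f y = g y) ->
  cderiv f z l -> cderiv g z l.
Proof.
  intros Hr E D. apply cderiv_intro. intros eps Heps.
  destruct (cderiv_elim _ _ _ D eps Heps) as [e [He Hf]].
  exists (Rmin e r). split; [now apply Rmin_glb_lt|]. intros y Hy.
  rewrite <- !E.
  - apply Hf. apply Rlt_le_trans with (1 := Hy). apply Rmin_l.
  - rewrite Cminus_diag. now rewrite Cmod_0.
  - apply Rlt_le_trans with (1 := Hy). apply Rmin_r.
Qed.

Lemma cderiv_inv (f : C -> C) (z l : C) :
  cderiv f z l -> f z <> 0%C ->
  cderiv (fun y => / f y)%C z (- l / (f z * f z))%C.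
Proof.
  intros Df H0.
  apply cderiv_eq with ((- / (f z * f z)) * l)%C; [|field; exact H0].
  apply (cderiv_comp Cinv f); [|exact Df].
  apply cderiv_ext_loc
    with (f := fun y => (/ f z - / f z * (/ y) * (y - f z))%C)
         (r := Cmod (f z)).
  - now apply Cmod_gt_0.
  - intros y Hy. field. split; [|exact H0].
    intros ->. replace (0 - f z)%C with (- f z)%C in Hy by ring.
    rewrite Cmod_opp in Hy. lra.
  - exists (fun y => (- (/ f z * / y))%C). split; [field; exact H0|]. split.
    + apply continuous_Copp, continuous_Cmult; [apply continuous_const|].
      now apply continuous_Cinv_id.
    + intros y. ring.
Qed.

Lemma cderiv_div (f g : C -> C) (z l m : C) :
  cderiv f z l -> cderiv g z m -> g z <> 0%C ->
  cderiv (fun y => f y / g y)%C z ((l * g z - f z * m) / (g z * g z))%C.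
Proof.
  intros Df Dg H0.
  apply cderiv_eq with (l * / g z + f z * (- m / (g z * g z)))%C.
  - apply (cderiv_mult f (fun y => / g y)%C); [exact Df|].
    now apply cderiv_inv.
  - field. exact H0.
Qed.

Lemma cderiv_pow (f : C -> C) (n : nat) (z l : C) :
  cderiv f z l -> exists m, cderiv (fun y => f y ^ n)%C z m.
Proof.
  intros Df. induction n as [|n [m Hm]]; simpl.
  - exists 0%C. apply cderiv_const.
  - eexists. apply cderiv_mult; eassumption.
Qed.

Lemma cderiv_of_is_derive (f : C -> C) (z l : C) :
  @is_derive C_AbsRing C_NormedModule f z l -> cderiv f z l.
Proof.
  intros [_ H]. apply cderiv_intro. intros eps Heps.
  specialize (H z (fun P H => H) (mkposreal eps Heps)).
  destruct H as [d Hd].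
  exists d. split; [apply cond_pos|]. intros y Hy.
  specialize (Hd y Hy). simpl in Hd.
  replace (l * (y - z))%C with ((y - z) * l)%C by ring. exact Hd.
Qed.

(** * Segments *)

Definition seg (a b : C) (t : R) : C := (a + RtoC t * (b - a))%C.

Lemma seg_0 (a b : C) : seg a b 0 = a.
Proof. unfold seg. ring. Qed.

Lemma seg_1 (a b : C) : seg a b 1 = b.
Proof. unfold seg. ring. Qed.

Lemma continuous_seg (a b : C) (t : R) : continuous (seg a b) t.
Proof.
  apply continuous_Cplus; [apply continuous_const|].
  apply continuous_Cmult; [|apply continuous_const].
  apply continuous_RtoC, continuous_id.
Qed.

Lemma minus_plus_cancel (G : AbelianGroup) (a b : G) :
  minus (plus a b) a = b.
Proof.
  transitivity (plus b (plus a (opp a))).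
  - unfold minus. rewrite (plus_comm a b). symmetry. apply plus_assoc.
  - rewrite plus_opp_r. apply plus_zero_r.
Qed.

(** The real counterpart of [cderiv], as a way into the derivatives over [R]. *)
Lemma is_derive_slope (V : NormedModule R_AbsRing) (W q : R -> V) (t : R) :
  continuous q t ->
  (forall u, W u = plus (W t) (scal (u - t) (q u))) ->
  is_derive W t (q t).
Proof.
  intros Cq HW. split; [apply is_linear_scal_l|].
  intros x Hx. 
  assert (E : t = x)
    by exact (@is_filter_lim_locally_unique R_AbsRing R_NormedModule t x Hx).
  rewrite <- E.
  intros eps.
  generalize (proj1 (filterlim_locally_ball_norm _ _) Cq eps).
  apply filter_imp. intros u Hu.
  change (norm (minus (minus (W u) (W t)) (scal (u - t) (q t)))
          <= eps * Rabs (u - t)).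
  replace (minus (minus (W u) (W t)) (scal (u - t) (q t)))
    with (scal (u - t) (minus (q u) (q t))).
  - apply Rle_trans with
      (1 := @norm_scal R_AbsRing V (u - t) (minus (q u) (q t))).
    rewrite Rmult_comm. apply Rmult_le_compat_r; [apply Rabs_pos|].
    left. exact Hu.
  - rewrite (HW u).
    transitivity (minus (scal (u - t) (q u)) (scal (u - t) (q t))).
    + exact (scal_minus_distr_l (u - t) (q u) (q t)).
    + apply (f_equal (fun v => minus v (scal (u - t) (q t)))).
      symmetry. exact (minus_plus_cancel V (W t) (scal (u - t) (q u))).
Qed.

Lemma is_derive_seg (F : C -> C) (a b : C) (t : R) (l : C) :
  cderiv F (seg a b t) l ->
  @is_derive R_AbsRing C_R_NormedModule
    (fun u => F (seg a b u)) t ((b - a) * l)%C.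
Proof.
  intros [q [<- [Cq HF]]].
  apply (is_derive_slope C_R_NormedModule (fun u => F (seg a b u))
           (fun u => ((b - a) * q (seg a b u))%C)).
  - apply continuous_Cmult; [apply continuous_const|].
    apply (continuous_comp (seg a b) q); [apply continuous_seg|exact Cq].
  - intros u. rewrite (HF (seg a b u)). rewrite scal_R_Cmult.
    change (plus (F (seg a b t)) (RtoC (u - t) * ((b - a) * q (seg a b u)))%C)
      with (F (seg a b t) + RtoC (u - t) * ((b - a) * q (seg a b u)))%C.
    unfold seg. rewrite RtoC_minus. Cring.
Qed.

(** A complex form of the mean value theorem: the real one applies to the
    projection of [F] on the direction of the increment. *)
Lemma cderiv_mean_value (F f : C -> C) (a b : C) (M : R) :
  (forall t, 0 <= t <= 1 -> cderiv F (seg a b t) (f (seg a b t))) ->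
  (forall t, 0 <= t <= 1 -> Cmod (f (seg a b t)) <= M) ->
  Cmod (F b - F a) <= M * Cmod (b - a).
Proof.
  intros HD HM. set (u := (F b - F a)%C).
  assert (HuD : forall t, 0 <= t <= 1 ->
     is_derive (fun s => Re (F (seg a b s) * Cconj u))%C t
       (Re ((b - a) * f (seg a b t) * Cconj u)%C)).
  { intros t Ht. destruct (HD t Ht) as [q [Hq [Cq HF]]]. rewrite <- Hq.
    apply (is_derive_slope R_NormedModule
             (fun s => Re (F (seg a b s) * Cconj u)%C)
             (fun s => Re ((b - a) * q (seg a b s) * Cconj u)%C)).
    - apply continuous_Re. apply continuous_Cmult; [|apply continuous_const].
      apply continuous_Cmult; [apply continuous_const|].
      apply (continuous_comp (seg a b) q); [apply continuous_seg|exact Cq].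
    - intros s. rewrite (HF (seg a b s)).
      match goal with |- ?l = plus ?x (scal ?c ?y) =>
        change (l = x + c * y) end.
      rewrite <- re_scal_l, <- re_plus. f_equal. unfold seg.
      rewrite RtoC_minus. ring. }
  destruct (MVT_gen (fun s => Re (F (seg a b s) * Cconj u)%C) 0 1
              (fun t => Re ((b - a) * f (seg a b t) * Cconj u)%C))
    as [c [Hc E]].
  - intros t Ht. rewrite Rmin_left, Rmax_right in Ht by lra.
    apply HuD. lra.
  - intros t Ht. rewrite Rmin_left, Rmax_right in Ht by lra.
    apply continuity_pt_filterlim.
    apply (ex_derive_continuous (V := R_NormedModule)).
    eexists. now apply HuD.
  - rewrite Rmin_left, Rmax_right in Hc by lra.
    rewrite seg_0, seg_1 in E.
    assert (E2 : Cmod u ^ 2 <= M * Cmod (b - a) * Cmod u).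
    { rewrite Cmod2_alt.
      replace (Re u ^ 2 + Im u ^ 2)
        with (Re (F b * Cconj u)%C - Re (F a * Cconj u)%C).
      - rewrite E. rewrite Rminus_0_r, Rmult_1_r.
        apply Rle_trans with (1 := Rle_abs _).
        apply Rle_trans with (1 := re_le_Cmod _).
        rewrite !Cmod_mult, Cmod_conj.
        apply Rmult_le_compat_r; [apply Cmod_ge_0|].
        rewrite Rmult_comm. apply Rmult_le_compat_r; [apply Cmod_ge_0|].
        now apply HM.
      - unfold u. destruct (F b) as [x y], (F a) as [x' y']. simpl. ring. }
    destruct (Req_dec (Cmod u) 0) as [E0|N].
    + fold u. rewrite E0. apply Rmult_le_pos; [|apply Cmod_ge_0].
      apply Rle_trans with (2 := HM 0 ltac:(lra)). apply Cmod_ge_0.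
    + pose proof (Cmod_ge_0 u). fold u.
      apply Rmult_le_reg_r with (Cmod u); nra.
Qed.

(** * Line integrals along segments *)

Definition seg_int (f : C -> C) (a b : C) : C :=
  @RInt C_R_CompleteNormedModule (fun t => ((b - a) * f (seg a b t))%C) 0 1.

Definition continuous_on_seg (f : C -> C) (a b : C) : Prop :=
  forall t, 0 <= t <= 1 -> continuous f (seg a b t).

Lemma continuous_seg_integrand (f : C -> C) (a b : C) (t : R) :
  continuous f (seg a b t) ->
  continuous (fun u => ((b - a) * f (seg a b u))%C) t.
Proof.
  intros H. apply continuous_Cmult; [apply continuous_const|].
  apply (continuous_comp (seg a b) f); [apply continuous_seg|exact H].
Qed.

Lemma ex_seg_int (f : C -> C) (a b : C) (u v : R) :
  continuous_on_seg f a b -> 0 <= u <= 1 -> 0 <= v <= 1 ->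
  @ex_RInt C_R_CompleteNormedModule
    (fun t => ((b - a) * f (seg a b t))%C) u v.
Proof.
  intros H Hu Hv.
  apply (@ex_RInt_continuous C_R_CompleteNormedModule). intros t Ht.
  apply continuous_seg_integrand. apply H.
  pose proof (Rmin_glb u v 0). pose proof (Rmax_lub u v 1). lra.
Qed.

Lemma RInt_C_ext (f g : R -> C) (u v : R) :
  (forall t, f t = g t) ->
  @RInt C_R_CompleteNormedModule f u v = @RInt C_R_CompleteNormedModule g u v.
Proof.
  intros E. apply (@RInt_ext C_R_CompleteNormedModule). intros t _. apply E.
Qed.

(** Reversing a segment and cutting it are both affine changes of the
    parameter. *)
Lemma seg_int_affine (f : C -> C) (a b : C) (u v : R) :
  continuous_on_seg f a b -> 0 <= v <= 1 -> 0 <= u + v <= 1 ->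
  seg_int f (seg a b v) (seg a b (u + v)) =
  @RInt C_R_CompleteNormedModule
    (fun t => ((b - a) * f (seg a b t))%C) v (u + v).
Proof.
  intros H Hv Huv.
  pose proof (@RInt_comp_lin C_R_CompleteNormedModule
    (fun t => ((b - a) * f (seg a b t))%C) u v 0 1) as E.
  rewrite Rmult_0_r, Rmult_1_r, Rplus_0_l in E.
  rewrite <- E by now apply ex_seg_int.
  unfold seg_int. apply RInt_C_ext. intros t. rewrite scal_R_Cmult.
  replace (seg (seg a b v) (seg a b (u + v)) t) with (seg a b (u * t + v)).
  - unfold seg. rewrite RtoC_plus. Cring.
  - unfold seg. rewrite !RtoC_plus, RtoC_mult. ring.
Qed.

Lemma seg_int_swap (f : C -> C) (a b : C) :
  continuous_on_seg f a b -> seg_int f b a = (- seg_int f a b)%C.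
Proof.
  intros H. pose proof (seg_int_affine f a b (-1) 1 H) as E.
  replace (-1 + 1) with 0 in E by ring. rewrite seg_0, seg_1 in E.
  rewrite E by lra. symmetry.
  exact (@opp_RInt_swap C_R_CompleteNormedModule _ 0 1
           (ex_seg_int f a b 0 1 H ltac:(lra) ltac:(lra))).
Qed.

Lemma seg_int_split (f : C -> C) (a b : C) (r : R) :
  continuous_on_seg f a b -> 0 <= r <= 1 ->
  seg_int f a b = (seg_int f a (seg a b r) + seg_int f (seg a b r) b)%C.
Proof.
  intros H Hr.
  pose proof (seg_int_affine f a b r 0 H) as E1.
  pose proof (seg_int_affine f a b (1 - r) r H) as E2.
  rewrite Rplus_0_r, seg_0 in E1. replace (1 - r + r) with 1 in E2 by ring.
  rewrite seg_1 in E2. rewrite E1, E2 by lra. symmetry.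
  apply (@RInt_Chasles C_R_CompleteNormedModule);
    apply ex_seg_int; try exact H; lra.
Qed.

Lemma seg_int_bound (f : C -> C) (a b : C) (M : R) :
  continuous_on_seg f a b ->
  (forall t, 0 <= t <= 1 -> Cmod (f (seg a b t)) <= M) ->
  Cmod (seg_int f a b) <= M * Cmod (b - a).
Proof.
  intros H HM. rewrite Cmod_norm.
  replace (M * Cmod (b - a)) with ((1 - 0) * (M * Cmod (b - a))) by ring.
  apply (@norm_RInt_le_const C_R_NormedModule
    (fun t => ((b - a) * f (seg a b t))%C)); [lra| |].
  - intros t Ht.
    apply Rle_trans with (Cmod ((b - a) * f (seg a b t))%C).
    + rewrite Cmod_norm. apply Rle_refl.
    + rewrite Cmod_mult, Rmult_comm.
      apply Rmult_le_compat_r; [apply Cmod_ge_0|]. now apply HM.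
  - apply (@RInt_correct C_R_CompleteNormedModule).
    apply ex_seg_int; try exact H; lra.
Qed.

Lemma seg_int_minus (f g : C -> C) (a b : C) :
  continuous_on_seg f a b -> continuous_on_seg g a b ->
  seg_int (fun z => f z - g z)%C a b = (seg_int f a b - seg_int g a b)%C.
Proof.
  intros Hf Hg. unfold seg_int.
  rewrite <- (@RInt_minus C_R_CompleteNormedModule)
    by (apply ex_seg_int; try assumption; lra).
  apply RInt_C_ext. intros t.
  change ((b - a) * (f (seg a b t) - g (seg a b t))
          = (b - a) * f (seg a b t) - (b - a) * g (seg a b t))%C.
  ring.
Qed.

Lemma seg_int_derivative (F f : C -> C) (a b : C) :
  continuous_on_seg f a b ->
  (forall t, 0 <= t <= 1 -> cderiv F (seg a b t) (f (seg a b t))) ->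
  seg_int f a b = (F b - F a)%C.
Proof.
  intros Hf HF.
  replace (F b - F a)%C with (F (seg a b 1) - F (seg a b 0))%C
    by now rewrite seg_0, seg_1.
  apply (@is_RInt_unique C_R_CompleteNormedModule).
  apply (@is_RInt_derive C_R_CompleteNormedModule (fun t => F (seg a b t))).
  - intros t Ht. rewrite Rmin_left, Rmax_right in Ht by lra.
    apply is_derive_seg. now apply HF.
  - intros t Ht. rewrite Rmin_left, Rmax_right in Ht by lra.
    apply continuous_seg_integrand. now apply Hf.
Qed.

(** * Goursat's theorem *)

Definition triangle_int (f : C -> C) (T : C * C * C) : C :=
  let '(a, b, c) := T in (seg_int f a b + seg_int f b c + seg_int f c a)%C.

Definition vertices_in (S : C -> Prop) (T : C * C * C) : Prop :=
  let '(a, b, c) := T in S a /\ S b /\ S c.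

Definition sides_le (T : C * C * C) (L : R) : Prop :=
  let '(a, b, c) := T in
  Cmod (b - a) <= L /\ Cmod (c - b) <= L /\ Cmod (a - c) <= L.

Definition convex_region (S : C -> Prop) : Prop :=
  forall a b t, S a -> S b -> 0 <= t <= 1 -> S (seg a b t).

Definition closed_region (S : C -> Prop) : Prop :=
  forall z, (forall eps, 0 < eps -> exists y, S y /\ Cmod (y - z) < eps) -> S z.

Lemma RtoC_half : RtoC (1 / 2) = (/ 2)%C.
Proof. rewrite RtoC_div by lra. field. Qed.

(** Joining the midpoints of the sides makes four triangles; the integrals along
    the inner segments cancel, so that one of the four carries at least a quarter of
    the integral.  The control of the first vertex makes the first vertices of
    iterated choices converge. *)
Lemma triangle_quarter (f : C -> C) (S : C -> Prop) (T : C * C * C) :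
  convex_region S -> (forall z, S z -> continuous f z) -> vertices_in S T ->
  exists T', vertices_in S T' /\
    Cmod (triangle_int f T) / 4 <= Cmod (triangle_int f T') /\
    forall L, sides_le T L ->
      sides_le T' (L / 2) /\ Cmod (fst (fst T') - fst (fst T)) <= L.
Proof.
  destruct T as [[a b] c]. intros HS Hf [Ha [Hb Hc]].
  set (p := seg a b (1 / 2)). set (q := seg b c (1 / 2)).
  set (r := seg c a (1 / 2)).
  assert (Hp : S p) by (apply HS; trivial; lra).
  assert (Hq : S q) by (apply HS; trivial; lra).
  assert (Hr : S r) by (apply HS; trivial; lra).
  assert (Hseg : forall x y, S x -> S y -> continuous_on_seg f x y).
  { intros x y Hx Hy t Ht. apply Hf. now apply HS. }
  assert (E : triangle_int f (a, b, c) =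
    (triangle_int f (a, p, r) + triangle_int f (p, b, q) +
     (triangle_int f (r, q, c) + triangle_int f (p, q, r)))%C).
  { simpl.
    rewrite (seg_int_split f a b (1 / 2)) by (try apply Hseg; trivial; lra).
    rewrite (seg_int_split f b c (1 / 2)) by (try apply Hseg; trivial; lra).
    rewrite (seg_int_split f c a (1 / 2)) by (try apply Hseg; trivial; lra).
    fold p q r.
    rewrite (seg_int_swap f p q), (seg_int_swap f q r), (seg_int_swap f r p)
      by (apply Hseg; trivial).
    ring. }
  assert (Hall : Cmod (triangle_int f (a, b, c)) <=
     Cmod (triangle_int f (a, p, r)) + Cmod (triangle_int f (p, b, q)) +
     (Cmod (triangle_int f (r, q, c)) + Cmod (triangle_int f (p, q, r)))).
  { rewrite E. apply Rle_trans with (1 := Cmod_triangle _ _).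
    apply Rplus_le_compat; apply Cmod_triangle. }
  assert (Hhalf : forall w z L, w = (/ 2 * z)%C \/ w = (- (/ 2 * z))%C ->
            Cmod z <= L -> Cmod w <= L / 2).
  { intros w z L [-> | ->] Hz; rewrite <- RtoC_half, ?Cmod_opp, Cmod_mult,
      Cmod_R, Rabs_pos_eq by lra; lra. }
  assert (Hsides : forall L, sides_le (a, b, c) L ->
    sides_le (a, p, r) (L / 2) /\ sides_le (p, b, q) (L / 2) /\
    sides_le (r, q, c) (L / 2) /\ sides_le (p, q, r) (L / 2)).
  { intros L [L1 [L2 L3]]. unfold p, q, r, seg. rewrite RtoC_half.
    repeat split.
    all: first
      [ apply (Hhalf _ (b - a)%C L); [first [left; field | right; field]
                                     | exact L1]
      | apply (Hhalf _ (c - b)%C L); [first [left; field | right; field]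
                                     | exact L2]
      | apply (Hhalf _ (a - c)%C L); [first [left; field | right; field]
                                     | exact L3] ]. }
  assert (Hfirst : forall L, sides_le (a, b, c) L ->
    Cmod (a - a) <= L /\ Cmod (p - a) <= L /\ Cmod (r - a) <= L).
  { intros L HL. destruct (Hsides L HL) as [[K1 [_ K3]] _].
    destruct HL as [L1 _]. pose proof (Cmod_ge_0 (b - a)).
    rewrite Cminus_diag, Cmod_0. rewrite (Cmod_minus_sym r a). lra. }
  destruct (Rle_dec (Cmod (triangle_int f (a, b, c)) / 4)
              (Cmod (triangle_int f (a, p, r)))) as [H1|H1].
  { exists (a, p, r). split; [now repeat split|]. split; [exact H1|].
    intros L HL. split; [now apply Hsides|now apply Hfirst]. }
  destruct (Rle_dec (Cmod (triangle_int f (a, b, c)) / 4)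
              (Cmod (triangle_int f (p, b, q)))) as [H2|H2].
  { exists (p, b, q). split; [now repeat split|]. split; [exact H2|].
    intros L HL. split; [now apply Hsides|now apply Hfirst]. }
  destruct (Rle_dec (Cmod (triangle_int f (a, b, c)) / 4)
              (Cmod (triangle_int f (r, q, c)))) as [H3|H3].
  { exists (r, q, c). split; [now repeat split|]. split; [exact H3|].
    intros L HL. split; [now apply Hsides|now apply Hfirst]. }
  exists (p, q, r). split; [now repeat split|]. split.
  - apply Rnot_le_lt in H1, H2, H3. lra.
  - intros L HL. split; [now apply Hsides|now apply Hfirst].
Qed.

Lemma halving_sequence_limit (x : nat -> R) (L : R) :
  (forall n, Rabs (x (S n) - x n) <= L / 2 ^ n) ->
  exists l, forall n, Rabs (x n - l) <= 2 * L / 2 ^ n.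
Proof.
  intros H. set (e := fun n => 2 * L / 2 ^ n).
  assert (Hp : forall n, 0 < 2 ^ n) by (intros n; apply pow_lt; lra).
  assert (Hstep : forall n, e n - e (S n) = L / 2 ^ n).
  { intros n. unfold e. simpl. pose proof (Hp n). field. lra. }
  assert (HL : 0 <= L).
  { pose proof (H O) as H0. pose proof (Rabs_pos (x 1%nat - x O)).
    simpl in H0. lra. }
  assert (Hup : forall n k, x n - e n <= x (k + n)%nat - e (k + n)%nat).
  { intros n k. induction k as [|k IH]; simpl; [lra|].
    pose proof (Hstep (k + n)%nat). pose proof (H (k + n)%nat) as A.
    apply Rabs_le_between in A. lra. }
  assert (Hdn : forall n k, x (k + n)%nat + e (k + n)%nat <= x n + e n).
  { intros n k. induction k as [|k IH]; simpl; [lra|].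
    pose proof (Hstep (k + n)%nat). pose proof (H (k + n)%nat) as A.
    apply Rabs_le_between in A. lra. }
  assert (He : forall n, 0 <= e n).
  { intros n. unfold e. apply Rmult_le_pos; [lra|].
    left. apply Rinv_0_lt_compat, Hp. }
  assert (Hnm : forall n m, x n - e n <= x m + e m).
  { intros n m. pose proof (Hup n m). pose proof (Hdn m n).
    rewrite (Nat.add_comm n m) in H1. pose proof (He (m + n)%nat). lra. }
  destruct (completeness (fun y => exists n, y = x n - e n)) as [l [Hl1 Hl2]].
  - exists (x O + e O). intros y [n ->]. apply Hnm.
  - exists (x O - e O). now exists O.
  - exists l. intros n. apply Rabs_le. split.
    + assert (l <= x n + e n); [|unfold e in *; lra].
      apply Hl2. intros y [m ->]. apply Hnm.
    + assert (x n - e n <= l); [|unfold e in *; lra].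
      apply Hl1. now exists n.
Qed.

Lemma halving_sequence_limit_C (z : nat -> C) (L : R) :
  (forall n, Cmod (z (S n) - z n) <= L / 2 ^ n) ->
  exists p, forall n, Cmod (z n - p) <= 4 * L / 2 ^ n.
Proof.
  intros H.
  destruct (halving_sequence_limit (fun n => Re (z n)) L) as [p Hp].
  { intros n. apply Rle_trans with (2 := H n).
    replace (Re (z (S n)) - Re (z n)) with (Re (z (S n) - z n)%C)
      by (destruct (z (S n)), (z n); reflexivity).
    apply re_le_Cmod. }
  destruct (halving_sequence_limit (fun n => Im (z n)) L) as [q Hq].
  { intros n. apply Rle_trans with (2 := H n).
    replace (Im (z (S n)) - Im (z n)) with (Im (z (S n) - z n)%C)
      by (destruct (z (S n)), (z n); reflexivity).
    apply im_le_Cmod. }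
  exists (p, q). intros n. apply Rle_trans with (1 := Cmod_le_re_im _).
  specialize (Hp n). specialize (Hq n). destruct (z n) as [u v]. simpl in *.
  unfold Rdiv, Rminus in *. lra.
Qed.

(** After [n] subdivisions the retained integral is at least [4 ^ - n] times the first
    one, whereas differentiability at the limit point bounds it by an arbitrarily
    small multiple of the square of the size, which is of order [4 ^ - n]. *)
Theorem goursat (f : C -> C) (S : C -> Prop) (T : C * C * C) :
  convex_region S -> closed_region S ->
  (forall z, S z -> exists l, cderiv f z l) ->
  vertices_in S T -> triangle_int f T = 0%C.
Proof.
  intros HS HC Hf HT.
  assert (Hcont : forall z, S z -> continuous f z).
  { intros z Hz. destruct (Hf z Hz) as [l Hl]. exact (cderiv_continuous _ _ _ Hl). }
  assert (Hex : forall T, exists T', vertices_in S T -> vertices_in S T' /\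
    Cmod (triangle_int f T) / 4 <= Cmod (triangle_int f T') /\
    forall L, sides_le T L ->
      sides_le T' (L / 2) /\ Cmod (fst (fst T') - fst (fst T)) <= L).
  { intros U. destruct (classic (vertices_in S U)) as [HU|HU].
    - destruct (triangle_quarter f S U HS Hcont HU) as [T' HT'].
      now exists T'.
    - now exists U. }
  set (next := fun U => proj1_sig (constructive_indefinite_description _ (Hex U))).
  set (Tn := fix Tn (n : nat) := match n with O => T | Datatypes.S m => next (Tn m) end).
  assert (Hnext : forall U, vertices_in S U -> vertices_in S (next U) /\
    Cmod (triangle_int f U) / 4 <= Cmod (triangle_int f (next U)) /\
    forall L, sides_le U L ->
      sides_le (next U) (L / 2) /\ Cmod (fst (fst (next U)) - fst (fst U)) <= L).
  { intros U. exact (proj2_sig (constructive_indefinite_description _ (Hex U))). }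
  clearbody next. clear Hex.
  assert (Hin : forall n, vertices_in S (Tn n)).
  { induction n as [|n IH]; [exact HT|]. now apply Hnext. }
  assert (Hbig : forall n, Cmod (triangle_int f T) / 4 ^ n
                           <= Cmod (triangle_int f (Tn n))).
  { induction n as [|n IH]; simpl; [lra|].
    apply Rle_trans with (2 := proj1 (proj2 (Hnext _ (Hin n)))).
    assert (0 < 4 ^ n) by (apply pow_lt; lra).
    replace (Cmod (triangle_int f T) / (4 * 4 ^ n))
      with (Cmod (triangle_int f T) / 4 ^ n / 4) by (field; lra).
    lra. }
  assert (HL : exists L, 0 < L /\ sides_le T L).
  { destruct T as [[a b] c].
    exists (1 + Cmod (b - a) + Cmod (c - b) + Cmod (a - c)).
    pose proof (Cmod_ge_0 (b - a)). pose proof (Cmod_ge_0 (c - b)).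
    pose proof (Cmod_ge_0 (a - c)). simpl. lra. }
  destruct HL as [L [HL0 HL]].
  assert (Hside : forall n, sides_le (Tn n) (L / 2 ^ n)).
  { induction n as [|n IH].
    - simpl. now rewrite Rdiv_1_r.
    - assert (0 < 2 ^ n) by (apply pow_lt; lra).
      replace (L / 2 ^ Datatypes.S n) with (L / 2 ^ n / 2) by (simpl; field; lra).
      now apply (Hnext _ (Hin n)). }
  destruct (halving_sequence_limit_C (fun n => fst (fst (Tn n))) L) as [p Hp].
  { intros n. now apply (Hnext _ (Hin n)). }
  assert (Hsmall : forall d, 0 < d -> exists n, 6 * (L / 2 ^ n) < d).
  { intros d Hd.
    assert (Hd' : 0 < d / (6 * L)) by (apply Rdiv_lt_0_compat; lra).
    destruct (pow_lt_1_zero (1 / 2) ltac:(rewrite Rabs_pos_eq; lra) _ Hd')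
      as [n Hn].
    exists n. specialize (Hn n (le_n n)).
    assert (0 < 2 ^ n) by (apply pow_lt; lra).
    rewrite Rabs_pos_eq in Hn by (apply pow_le; lra).
    unfold Rdiv at 1 in Hn. rewrite Rmult_1_l, pow_inv in Hn.
    apply Rmult_lt_compat_r with (r := 6 * L) in Hn; [|lra].
    unfold Rdiv in Hn. rewrite Rmult_assoc, Rinv_l in Hn by lra.
    unfold Rdiv. lra. }
  assert (HpS : S p).
  { apply HC. intros eps Heps. destruct (Hsmall eps Heps) as [n Hn].
    exists (fst (fst (Tn n))). split.
    - pose proof (Hin n). destruct (Tn n) as [[a b] c]. apply H.
    - apply Rle_lt_trans with (1 := Hp n).
      assert (0 < L / 2 ^ n)
        by (apply Rdiv_lt_0_compat; [lra|apply pow_lt; lra]).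
      unfold Rdiv in *. lra. }
  destruct (Hf p HpS) as [l Hl].
  apply Cmod_eq_0. apply Rle_antisym; [|apply Cmod_ge_0].
  apply le_epsilon. intros e0 He0. rewrite Rplus_0_l.
  set (eps := e0 / (18 * (L * L))).
  assert (Heps : 0 < eps) by (apply Rdiv_lt_0_compat; nra).
  destruct (cderiv_elim _ _ _ Hl eps Heps) as [d [Hd Hfd]].
  destruct (Hsmall d Hd) as [n Hn].
  (* Subtracting from [f] its affine part at the limit point changes no
     integral over a closed triangle. *)
  set (A := fun y => (f p + l * (y - p))%C).
  set (P := fun y => (f p * y + l * ((y - p) * (y - p)) * / 2)%C).
  assert (HA : forall y, cderiv P y (A y)).
  { intros y. unfold P, A.
    apply cderiv_eq with (0 * y + f p * 1 +
      ((0 * ((y - p) * (y - p)) + l * ((1 - 0) * (y - p) + (y - p) * (1 - 0)))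
       * / 2 + (l * ((y - p) * (y - p))) * 0))%C; [|field].
    apply cderiv_plus.
    - apply (cderiv_mult (fun _ => f p) (fun y => y)); [apply cderiv_const|apply cderiv_id].
    - apply (cderiv_mult (fun y => l * ((y - p) * (y - p)))%C (fun _ => / 2)%C);
        [|apply cderiv_const].
      apply (cderiv_mult (fun _ => l) (fun y => (y - p) * (y - p))%C);
        [apply cderiv_const|].
      apply (cderiv_mult (fun y => y - p)%C (fun y => y - p)%C);
        apply (cderiv_minus (fun y => y) (fun _ => p));
        (apply cderiv_const || apply cderiv_id). }
  assert (HAc : forall y, continuous A y).
  { intros y. apply continuous_Cplus; [apply continuous_const|].
    apply continuous_Cmult; [apply continuous_const|].
    apply continuous_Cminus; [apply continuous_id|apply continuous_const]. }
  specialize (Hbig n). specialize (Hin n). specialize (Hside n).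
  specialize (Hp n). destruct (Tn n) as [[a b] c].
  destruct Hin as [Ia [Ib Ic]]. destruct Hside as [S1 [S2 S3]]. simpl in Hp.
  set (s := L / 2 ^ n) in *.
  replace (4 * L / 2 ^ n) with (4 * s) in Hp by (unfold s, Rdiv; ring).
  assert (Hs : 0 < s) by (apply Rdiv_lt_0_compat; [lra|apply pow_lt; lra]).
  assert (Hedge : forall x y, S x -> S y -> Cmod (x - a) <= s ->
     Cmod (y - x) <= s ->
     Cmod (seg_int f x y - (P y - P x)) <= eps * (6 * s) * s).
  { intros x y Hx Hy Hxa Hyx.
    assert (Cf : continuous_on_seg f x y)
      by (intros t Ht; apply Hcont; now apply HS).
    assert (CA : continuous_on_seg A x y) by (intros t Ht; apply HAc).
    rewrite <- (seg_int_derivative P A) by (try exact CA; intros; apply HA).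
    rewrite <- seg_int_minus by assumption.
    apply Rle_trans with (eps * (6 * s) * Cmod (y - x)).
    2: { apply Rmult_le_compat_l; [|exact Hyx]. nra. }
    apply seg_int_bound.
    { intros t Ht. apply continuous_Cminus; [now apply Cf|now apply CA]. }
    intros t Ht.
    assert (Hdist : Cmod (seg x y t - p) <= 6 * s).
    { replace (seg x y t - p)%C
        with (RtoC t * (y - x) + ((x - a) + (a - p)))%C by (unfold seg; ring).
      apply Rle_trans with (1 := Cmod_triangle _ _).
      assert (Cmod (RtoC t * (y - x)) <= s).
      { rewrite Cmod_mult, Cmod_R, Rabs_pos_eq by lra.
        pose proof (Cmod_ge_0 (y - x)). nra. }
      pose proof (Cmod_triangle (x - a) (a - p)). lra. }
    replace (f (seg x y t) - A (seg x y t))%C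
      with (f (seg x y t) - f p - l * (seg x y t - p))%C by (unfold A; ring).
    apply Rle_trans with (eps * Cmod (seg x y t - p)).
    - apply Hfd. lra.
    - apply Rmult_le_compat_l; lra. }
  assert (Htri : Cmod (triangle_int f (a, b, c)) <= 3 * (eps * (6 * s) * s)).
  { simpl.
    replace (seg_int f a b + seg_int f b c + seg_int f c a)%C
      with ((seg_int f a b - (P b - P a)) + (seg_int f b c - (P c - P b))
            + (seg_int f c a - (P a - P c)))%C by ring.
    apply Rle_trans with (1 := Cmod_triangle _ _).
    pose proof (Cmod_triangle (seg_int f a b - (P b - P a))
                  (seg_int f b c - (P c - P b))).
    pose proof (Hedge a b Ia Ib ltac:(rewrite Cminus_diag, Cmod_0; lra) S1).
    pose proof (Hedge b c Ib Ic S1 S2).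
    pose proof (Hedge c a Ic Ia ltac:(rewrite Cmod_minus_sym; exact S3) S3).
    lra. }
  assert (E4 : Cmod (triangle_int f T) / 4 ^ n * (L * L)
               = Cmod (triangle_int f T) * (s * s)).
  { assert (0 < 2 ^ n) by (apply pow_lt; lra).
    replace (4 ^ n) with (2 ^ n * 2 ^ n)
      by (rewrite <- Rpow_mult_distr; f_equal; lra).
    unfold s. field. lra. }
  assert (Cmod (triangle_int f T) * (s * s) <= e0 * (s * s)).
  { rewrite <- E4. apply Rle_trans with (3 * (eps * (6 * s) * s) * (L * L)).
    - apply Rmult_le_compat_r; [nra|]. lra.
    - right. unfold eps. field. lra. }
  apply Rmult_le_reg_r with (s * s); nra.
Qed.

(** * Primitives on the disk *)

Lemma disk_0 : disk 0.
Proof. unfold disk. rewrite Cmod_0. lra. Qed.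

Lemma seg_in_ball (a b : C) (r t : R) :
  Cmod a < r -> Cmod b < r -> 0 <= t <= 1 -> Cmod (seg a b t) < r.
Proof.
  intros Ha Hb Ht.
  replace (seg a b t) with (RtoC (1 - t) * a + RtoC t * b)%C
    by (unfold seg; rewrite RtoC_minus; ring).
  apply Rle_lt_trans with (1 := Cmod_triangle _ _).
  rewrite !Cmod_mult, !Cmod_R, !Rabs_pos_eq by lra.
  destruct (Req_dec t 0) as [->|N]; nra.
Qed.

Lemma seg_in_disk (a b : C) (t : R) :
  disk a -> disk b -> 0 <= t <= 1 -> disk (seg a b t).
Proof. apply seg_in_ball. Qed.

Lemma seg_int_local_bound (k : C -> C) (z : C) (eps : R) :
  disk z -> (forall y, disk y -> continuous k y) -> 0 < eps ->
  exists d, 0 < d /\ forall w, Cmod (w - z) < d ->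
    disk w /\ Cmod (seg_int k z w - k z * (w - z)) <= eps * Cmod (w - z).
Proof.
  intros Hz Hk Heps.
  destruct (proj1 (continuous_C_C _ _) (Hk z Hz) eps Heps) as [d [Hd Hkd]].
  unfold disk in Hz.
  exists (Rmin d (1 - Cmod z)). split; [apply Rmin_glb_lt; lra|].
  intros w Hw.
  pose proof (Rmin_l d (1 - Cmod z)). pose proof (Rmin_r d (1 - Cmod z)).
  pose proof (Cmod_reverse_triangle w z).
  assert (Hwd : disk w) by (unfold disk; lra). split; [exact Hwd|].
  assert (Hseg : continuous_on_seg k z w)
    by (intros t Ht; apply Hk; now apply seg_in_disk).
  replace (k z * (w - z))%C with (seg_int (fun _ => k z) z w).
  - rewrite <- seg_int_minus; [|exact Hseg|intros t Ht; apply continuous_const].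
    apply seg_int_bound.
    + intros t Ht. apply continuous_Cminus; [now apply Hseg|].
      apply continuous_const.
    + intros t Ht. left. apply Hkd.
      replace (seg z w t - z)%C with (RtoC t * (w - z))%C by (unfold seg; ring).
      rewrite Cmod_mult, Cmod_R, Rabs_pos_eq by lra.
      pose proof (Cmod_ge_0 (w - z)). nra.
  - rewrite (seg_int_derivative (fun y => k z * y)%C).
    + ring.
    + intros t Ht. apply continuous_const.
    + intros t Ht. apply cderiv_eq with (0 * seg z w t + k z * 1)%C; [|ring].
      apply (cderiv_mult (fun _ => k z) (fun y => y));
        [apply cderiv_const|apply cderiv_id].
Qed.

(** Regions on which Goursat's theorem will be used: with [0 < c] and [r < 1]
    they lie in the disk and avoid [0]. *)
Lemma half_plane_ball_convex (z : C) (c r : R) :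
  convex_region (fun y => c <= Re (y * Cconj z)%C /\ Cmod y <= r).
Proof.
  intros a b t [Ha1 Ha2] [Hb1 Hb2] Ht.
  replace (seg a b t) with (RtoC (1 - t) * a + RtoC t * b)%C
    by (unfold seg; rewrite RtoC_minus; ring).
  split.
  - replace ((RtoC (1 - t) * a + RtoC t * b) * Cconj z)%C
      with (RtoC (1 - t) * (a * Cconj z) + RtoC t * (b * Cconj z))%C by ring.
    rewrite re_plus, !re_scal_l. nra.
  - apply Rle_trans with (1 := Cmod_triangle _ _).
    rewrite !Cmod_mult, !Cmod_R, !Rabs_pos_eq by lra. nra.
Qed.

Lemma half_plane_ball_closed (z : C) (c r : R) :
  closed_region (fun y => c <= Re (y * Cconj z)%C /\ Cmod y <= r).
Proof.
  intros x Hx. cbv beta in *. split.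
  - apply le_epsilon. intros e He.
    pose proof (Cmod_ge_0 z) as Hz.
    destruct (Hx (e / (Cmod z + 1))) as [y [[Hy _] Hyx]].
    { apply Rdiv_lt_0_compat; lra. }
    assert (Re (y * Cconj z)%C - Re (x * Cconj z)%C <= e); [|lra].
    replace (Re (y * Cconj z)%C - Re (x * Cconj z)%C)
      with (Re ((y - x) * Cconj z)%C)
      by (destruct x, y, z; simpl; ring).
    apply Rle_trans with (1 := Rle_abs _).
    apply Rle_trans with (1 := re_le_Cmod _).
    rewrite Cmod_mult, Cmod_conj.
    apply Rmult_lt_compat_r with (r := Cmod z + 1) in Hyx; [|lra].
    unfold Rdiv in Hyx. rewrite Rmult_assoc, Rinv_l in Hyx by lra.
    pose proof (Cmod_ge_0 (y - x)). nra.
  - apply le_epsilon. intros e He.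
    destruct (Hx e He) as [y [[_ Hy] Hyx]].
    pose proof (Cmod_reverse_triangle x y).
    rewrite (Cmod_minus_sym x) in H. lra.
Qed.

(** The triangle with vertex [0] is exhausted by quadrilaterals avoiding [0],
    on which Goursat's theorem applies; what is left has perimeter tending
    to [0]. *)
Lemma triangle_int_exceptional_vertex (k : C -> C) (z w : C) :
  (forall y, disk y -> continuous k y) ->
  (forall y, disk y -> y <> 0%C -> exists l, cderiv k y l) ->
  disk z -> disk w -> z <> 0%C -> Cmod (w - z) <= Cmod z / 2 ->
  seg_int k 0 w = (seg_int k 0 z + seg_int k z w)%C.
Proof.
  intros Hc Hd Hz Hw Hz0 Hwz.
  pose proof (proj1 (Cmod_gt_0 z) Hz0) as Hzp.
  apply Ceq_minus. apply Cmod_eq_0. apply Rle_antisym; [|apply Cmod_ge_0].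
  apply le_epsilon. intros e He. rewrite Rplus_0_l.
  destruct (proj1 (continuous_C_C _ _) (Hc 0%C disk_0) 1 Rlt_0_1)
    as [d [Hd0 Hkd]].
  set (M := Cmod (k 0) + 1).
  assert (HM : 0 < M) by (pose proof (Cmod_ge_0 (k 0)); unfold M; lra).
  set (eta := Rmin (1 / 2) (Rmin (d / 2) (e / (4 * M)))).
  assert (He1 : eta <= 1 / 2) by apply Rmin_l.
  assert (He2 : eta <= d / 2)
    by (unfold eta; apply Rle_trans with (1 := Rmin_r _ _); apply Rmin_l).
  assert (He3 : eta <= e / (4 * M))
    by (unfold eta; apply Rle_trans with (1 := Rmin_r _ _); apply Rmin_r).
  assert (He0 : 0 < eta).
  { apply Rmin_glb_lt; [lra|]. apply Rmin_glb_lt; [lra|].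
    apply Rdiv_lt_0_compat; lra. }
  set (z' := seg 0 z eta). set (w' := seg 0 w eta).
  assert (Ez' : z' = (RtoC eta * z)%C) by (unfold z', seg; ring).
  assert (Ew' : w' = (RtoC eta * w)%C) by (unfold w', seg; ring).
  unfold disk in Hz, Hw.
  assert (Hz'm : Cmod z' <= eta).
  { rewrite Ez', Cmod_mult, Cmod_R, Rabs_pos_eq by lra. nra. }
  assert (Hw'm : Cmod w' <= eta).
  { rewrite Ew', Cmod_mult, Cmod_R, Rabs_pos_eq by lra. nra. }
  assert (Hz' : disk z') by (unfold disk; lra).
  assert (Hw' : disk w') by (unfold disk; lra).
  assert (Hcont : forall a b, disk a -> disk b -> continuous_on_seg k a b).
  { intros a b Ha Hb t Ht. apply Hc. now apply seg_in_disk. }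
  pose proof disk_0 as H0.
  (* [S] contains the vertices [z], [w], [w'], [z'] of the quadrilateral. *)
  set (S := fun y => eta * (Cmod z * Cmod z) / 2 <= Re (y * Cconj z)%C
                     /\ Cmod y <= Rmax (Cmod z) (Cmod w)).
  assert (Hzz : Re (z * Cconj z)%C = Cmod z * Cmod z).
  { rewrite <- Cmod2_conj. simpl. ring. }
  assert (Hwz' : Cmod z * Cmod z / 2 <= Re (w * Cconj z)%C).
  { replace (w * Cconj z)%C with (z * Cconj z + (w - z) * Cconj z)%C by ring.
    rewrite re_plus, Hzz.
    pose proof (re_le_Cmod ((w - z) * Cconj z)) as H.
    rewrite Cmod_mult, Cmod_conj in H. apply Rabs_le_between in H. nra. }
  assert (HSd : forall y, S y -> disk y /\ y <> 0%C).
  { intros y [Hy1 Hy2]. split.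
    - unfold disk. apply Rle_lt_trans with (1 := Hy2). now apply Rmax_lub_lt.
    - intros ->. rewrite Cmult_0_l in Hy1. simpl in Hy1.
      assert (0 < eta * (Cmod z * Cmod z)) by (apply Rmult_lt_0_compat; nra).
      lra. }
  assert (HSz : S z).
  { split; [rewrite Hzz; nra|apply Rmax_l]. }
  assert (HSw : S w).
  { split; [nra|apply Rmax_r]. }
  assert (HSz' : S z').
  { split.
    - rewrite Ez', <- Cmult_assoc, re_scal_l, Hzz. nra.
    - apply Rle_trans with (2 := Rmax_l _ _).
      rewrite Ez', Cmod_mult, Cmod_R, Rabs_pos_eq by lra. nra. }
  assert (HSw' : S w').
  { split.
    - rewrite Ew', <- Cmult_assoc, re_scal_l. nra.
    - apply Rle_trans with (2 := Rmax_r _ _).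
      rewrite Ew', Cmod_mult, Cmod_R, Rabs_pos_eq by lra.
      pose proof (Cmod_ge_0 w). nra. }
  assert (HSg : forall T, vertices_in S T -> triangle_int k T = 0%C).
  { intros T. apply goursat.
    - apply half_plane_ball_convex.
    - apply half_plane_ball_closed.
    - intros y Hy. apply Hd; now apply HSd. }
  pose proof (HSg (z', z, w) (conj HSz' (conj HSz HSw))) as G1.
  pose proof (HSg (z', w, w') (conj HSz' (conj HSw HSw'))) as G2.
  simpl in G1, G2.
  rewrite (seg_int_swap k z' w) in G1 by now apply Hcont.
  rewrite (seg_int_swap k w' w), (seg_int_swap k z' w') in G2
    by now apply Hcont.
  assert (E : (seg_int k 0 w - (seg_int k 0 z + seg_int k z w))%C
    = (seg_int k 0 w' - seg_int k 0 z' - seg_int k z' w')%C).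
  { rewrite (seg_int_split k 0 z eta) by (try apply Hcont; trivial; lra).
    rewrite (seg_int_split k 0 w eta) by (try apply Hcont; trivial; lra).
    fold z' w'.
    replace (seg_int k 0 w' + seg_int k w' w
             - (seg_int k 0 z' + seg_int k z' z + seg_int k z w))%C
      with (seg_int k 0 w' - seg_int k 0 z' - seg_int k z' w'
            - (seg_int k z' z + seg_int k z w + - seg_int k z' w)
            - (seg_int k z' w + - seg_int k w' w + - seg_int k z' w')
            - seg_int k z' w' + seg_int k z' w')%C by ring.
    rewrite G1, G2. ring. }
  rewrite E.
  assert (Hsmall : forall a b, Cmod a <= eta -> Cmod b <= eta ->
            Cmod (seg_int k a b) <= M * Cmod (b - a)).
  { intros a b Ha Hb. apply seg_int_bound.
    - apply Hcont; unfold disk; lra.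
    - intros t Ht.
      assert (Cmod (seg a b t - 0) < d).
      { replace (seg a b t - 0)%C with (seg a b t) by ring.
        apply seg_in_ball; lra. }
      pose proof (Hkd _ H) as Hk1.
      pose proof (Cmod_reverse_triangle (k (seg a b t)) (k 0)).
      unfold M. lra. }
  assert (Cmod (RtoC 0) <= eta) by (rewrite Cmod_0; lra).
  pose proof (Hsmall 0%C w' H Hw'm) as B1.
  pose proof (Hsmall 0%C z' H Hz'm) as B2.
  pose proof (Hsmall z' w' Hz'm Hw'm) as B3.
  pose proof (Cmod_triangle_minus w' 0) as T1. rewrite Cmod_0 in T1.
  pose proof (Cmod_triangle_minus z' 0) as T2. rewrite Cmod_0 in T2.
  pose proof (Cmod_triangle_minus w' z') as T3.
  pose proof (Cmod_triangle_minus (seg_int k 0 w' - seg_int k 0 z')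
    (seg_int k z' w')) as T4.
  pose proof (Cmod_triangle_minus (seg_int k 0 w') (seg_int k 0 z')) as T5.
  assert (M * (4 * eta) <= e).
  { apply Rle_trans with (M * (4 * (e / (4 * M)))).
    - apply Rmult_le_compat_l; lra.
    - right. field. lra. }
  assert (M * Cmod (w' - 0) <= M * eta) by (apply Rmult_le_compat_l; lra).
  assert (M * Cmod (z' - 0) <= M * eta) by (apply Rmult_le_compat_l; lra).
  assert (M * Cmod (w' - z') <= M * (2 * eta))
    by (apply Rmult_le_compat_l; lra).
  lra.
Qed.

(** The primitive is the integral along radii; [k] may fail to be
    differentiable at [0] because every triangle that the proof considers has a
    vertex there. *)
Theorem primitive_on_disk (k : C -> C) :
  (forall y, disk y -> continuous k y) ->
  (forall y, disk y -> y <> 0%C -> exists l, cderiv k y l) ->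
  exists K : C -> C, K 0%C = 0%C /\ forall z, disk z -> cderiv K z (k z).
Proof.
  intros Hc Hd. exists (fun z => seg_int k 0 z).
  assert (E0 : seg_int k 0 0 = 0%C).
  { apply Cmod_eq_0. apply Rle_antisym; [|apply Cmod_ge_0].
    apply Rle_trans with (Cmod (k 0%C) * Cmod (0 - 0));
      [|rewrite Cminus_diag, Cmod_0, Rmult_0_r; apply Rle_refl].
    apply seg_int_bound.
    - intros t Ht. apply Hc. apply seg_in_disk; trivial; apply disk_0.
    - intros t _. replace (seg 0 0 t) with (RtoC 0) by (unfold seg; ring).
      apply Rle_refl. }
  split; [exact E0|]. intros z Hz. apply cderiv_intro. intros eps Heps.
  destruct (seg_int_local_bound k z eps Hz Hc Heps) as [d [Hd0 Hloc]].
  destruct (Ceq_dec z 0) as [->|N].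
  - exists d. split; [exact Hd0|]. intros w Hw. rewrite E0.
    replace (seg_int k 0 w - 0 - k 0%C * (w - 0))%C
      with (seg_int k 0 w - k 0%C * (w - 0))%C by ring.
    now apply Hloc.
  - pose proof (proj1 (Cmod_gt_0 z) N) as Hp.
    exists (Rmin d (Cmod z / 2)). split; [apply Rmin_glb_lt; lra|].
    intros w Hw. pose proof (Rmin_l d (Cmod z / 2)).
    pose proof (Rmin_r d (Cmod z / 2)).
    destruct (Hloc w) as [Hwd Hb]; [lra|].
    rewrite (triangle_int_exceptional_vertex k z w) by (trivial; lra).
    replace (seg_int k 0 z + seg_int k z w - seg_int k 0 z - k z * (w - z))%C
      with (seg_int k z w - k z * (w - z))%C by ring.
    exact Hb.
Qed.

(** * The complex exponential *)

Definition Cexp (z : C) : C := (exp (Re z) * cos (Im z), exp (Re z) * sin (Im z)).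

Lemma Cexp_0 : Cexp 0 = 1%C.
Proof. unfold Cexp; simpl. rewrite exp_0, cos_0, sin_0. unfold RtoC. f_equal; ring. Qed.

Lemma Cexp_plus (a b : C) : Cexp (a + b) = (Cexp a * Cexp b)%C.
Proof.
  unfold Cexp. rewrite re_plus, im_plus, exp_plus, cos_plus, sin_plus.
  unfold Cmult; simpl. f_equal; ring.
Qed.

Lemma Cexp_real (z : C) : Im z = 0 -> Cexp z = RtoC (exp (Re z)).
Proof.
  intros E. unfold Cexp. rewrite E, cos_0, sin_0. unfold RtoC. f_equal; ring.
Qed.

Lemma derivable_pt_lim_expansion (f : R -> R) (l : R) :
  derivable_pt_lim f 0 l ->
  forall eps, 0 < eps -> exists d, 0 < d /\
    forall h, Rabs h < d -> Rabs (f h - f 0 - l * h) <= eps * Rabs h.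
Proof.
  intros H eps Heps. destruct (H eps Heps) as [d Hd].
  exists d. split; [apply cond_pos|]. intros h Hh.
  destruct (Req_dec h 0) as [->|N].
  - replace (f 0 - f 0 - l * 0) with 0 by ring. rewrite Rabs_R0. lra.
  - specialize (Hd h N Hh). rewrite Rplus_0_l in Hd.
    replace (f h - f 0 - l * h) with (((f h - f 0) / h - l) * h) by (field; exact N).
    rewrite Rabs_mult. apply Rmult_le_compat_r; [apply Rabs_pos|]. lra.
Qed.

Lemma cderiv_Cexp_0 : cderiv Cexp 0 1%C.
Proof.
  apply cderiv_intro. intros eps Heps.
  set (e := Rmin (eps / 8) 1).
  assert (He : 0 < e) by (apply Rmin_glb_lt; lra).
  assert (He8 : e <= eps / 8) by apply Rmin_l.
  assert (He1 : e <= 1) by apply Rmin_r.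
  pose proof (derivable_pt_lim_exp 0) as Dexp. rewrite exp_0 in Dexp.
  pose proof (derivable_pt_lim_sin 0) as Dsin. rewrite cos_0 in Dsin.
  pose proof (derivable_pt_lim_cos 0) as Dcos. rewrite sin_0, Ropp_0 in Dcos.
  destruct (derivable_pt_lim_expansion _ _ Dexp e He) as [d1 [D1 Hexp]].
  destruct (derivable_pt_lim_expansion _ _ Dsin e He) as [d2 [D2 Hsin]].
  destruct (derivable_pt_lim_expansion _ _ Dcos e He) as [d3 [D3 Hcos]].
  set (d := Rmin (Rmin d1 d2) (Rmin d3 (e / 2))).
  assert (Hd : 0 < d) by (repeat apply Rmin_glb_lt; lra).
  pose proof (Rmin_l (Rmin d1 d2) (Rmin d3 (e / 2))) as M1.
  pose proof (Rmin_r (Rmin d1 d2) (Rmin d3 (e / 2))) as M2.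
  fold d in M1, M2.
  pose proof (Rmin_l d1 d2). pose proof (Rmin_r d1 d2).
  pose proof (Rmin_l d3 (e / 2)). pose proof (Rmin_r d3 (e / 2)).
  exists d. split; [exact Hd|]. intros h Hh.
  replace (h - 0)%C with h in Hh by ring.
  rewrite Cexp_0. replace (Cexp h - 1 - 1 * (h - 0))%C with (Cexp h - 1 - h)%C by ring.
  replace (h - 0)%C with h by ring.
  pose proof (re_le_Cmod h) as Hx. pose proof (im_le_Cmod h) as Hy.
  apply Rle_trans with (1 := Cmod_le_re_im _).
  destruct h as [x y]. unfold Cexp. simpl in *.
  set (m := Cmod (x, y)) in *.
  specialize (Hexp x ltac:(lra)). specialize (Hsin y ltac:(lra)).
  specialize (Hcos y ltac:(lra)).
  rewrite exp_0 in Hexp. rewrite sin_0 in Hsin. rewrite cos_0 in Hcos.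
  pose proof (exp_pos x) as Hpos.
  assert (Hx1 : Rabs (exp x - 1) <= e).
  { replace (exp x - 1) with ((exp x - 1 - 1 * x) + x) by ring.
    pose proof (Rabs_triang (exp x - 1 - 1 * x) x). pose proof (Rabs_pos x). nra. }
  assert (Hx2 : exp x <= 2).
  { pose proof (Rle_abs (exp x - 1)). lra. }
  assert (Hre : Rabs (exp x * cos y + - (1) + - x) <= e * Rabs x + 2 * (e * Rabs y)).
  { replace (exp x * cos y + - (1) + - x)
      with ((exp x - 1 - 1 * x) + exp x * (cos y - 1 - 0 * y)) by ring.
    apply Rle_trans with (1 := Rabs_triang _ _).
    apply Rplus_le_compat; [exact Hexp|].
    rewrite Rabs_mult, (Rabs_pos_eq (exp x)) by lra.
    apply Rmult_le_compat; try lra. apply Rabs_pos. }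
  assert (Him : Rabs (exp x * sin y + - 0 + - y) <= e * Rabs y + 2 * (e * Rabs y)).
  { replace (exp x * sin y + - 0 + - y)
      with ((exp x - 1) * y + exp x * (sin y - 0 - 1 * y)) by ring.
    apply Rle_trans with (1 := Rabs_triang _ _).
    apply Rplus_le_compat; rewrite Rabs_mult.
    - apply Rmult_le_compat_r; [apply Rabs_pos|exact Hx1].
    - rewrite (Rabs_pos_eq (exp x)) by lra.
      apply Rmult_le_compat; try lra. apply Rabs_pos. }
  apply Rle_trans with ((e * Rabs x + 2 * (e * Rabs y)) + (e * Rabs y + 2 * (e * Rabs y))).
  - apply Rplus_le_compat; assumption.
  - pose proof (Rabs_pos x). pose proof (Rabs_pos y). nra.
Qed.

Lemma cderiv_Cexp (z : C) : cderiv Cexp z (Cexp z).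
Proof.
  apply cderiv_ext with (f := fun y => (Cexp z * Cexp (y - z))%C).
  { intros y. rewrite <- Cexp_plus. f_equal. ring. }
  apply cderiv_eq with (0 * Cexp (z - z) + Cexp z * (1 * (1 - 0)))%C; [|ring].
  apply (cderiv_mult (fun _ => Cexp z) (fun y => Cexp (y - z)));
    [apply cderiv_const|].
  apply (cderiv_comp Cexp (fun y => y - z)%C).
  - rewrite Cminus_diag. apply cderiv_Cexp_0.
  - apply (cderiv_minus (fun y => y) (fun _ => z));
      [apply cderiv_id|apply cderiv_const].
Qed.

(** * A maximum principle along paths joining two rays *)

Definition differentiable_on_disk (f : C -> C) : Prop :=
  forall z, disk z -> exists l, cderiv f z l.

Lemma differentiable_continuous (f : C -> C) (z : C) :
  differentiable_on_disk f -> disk z -> continuous f z.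
Proof.
  intros Hf Hz. destruct (Hf z Hz) as [l Hl]. exact (cderiv_continuous _ _ _ Hl).
Qed.

Lemma RtoC_neq_0 (x : R) : x <> 0 -> RtoC x <> 0%C.
Proof. intros N E. apply N. now apply RtoC_inj. Qed.

(** The class of [0] is open and closed in the interval.  This propagates a local
    comparison along a path without a subdivision fixed in advance. *)
Lemma path_equivalence (rel : R -> R -> Prop) :
  (forall s t, rel s t -> rel t s) ->
  (forall s t u, rel s t -> rel t u -> rel s u) ->
  (forall t, 0 <= t <= 1 -> exists d, 0 < d /\
     forall u, 0 <= u <= 1 -> Rabs (u - t) < d -> rel t u) ->
  rel 0 1.
Proof.
  intros Hsym Htrans Hloc.
  set (E := fun u => 0 <= u <= 1 /\ rel 0 u).
  assert (E0 : E 0).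
  { destruct (Hloc 0 ltac:(lra)) as [d [Hd H]]. split; [lra|].
    apply H; [lra|]. rewrite Rminus_0_r, Rabs_R0. exact Hd. }
  destruct (completeness E) as [m [Hm1 Hm2]].
  { exists 1. intros u Hu. apply Hu. }
  { now exists 0. }
  assert (Hm : 0 <= m <= 1).
  { split; [now apply Hm1|]. apply Hm2. intros u Hu. apply Hu. }
  destruct (Hloc m Hm) as [d [Hd H]].
  assert (Em : rel 0 m).
  { destruct (classic (exists u, E u /\ m - d < u)) as [[u [[Hu Eu] Hmu]]|N].
    - apply Htrans with u; [exact Eu|]. apply Hsym, H; [exact Hu|].
      assert (u <= m) by (apply Hm1; now split).
      rewrite Rabs_left1; lra.
    - assert (m <= m - d); [|lra]. apply Hm2. intros u Hu.
      apply Rnot_lt_le. intros C. apply N. now exists u. }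
  destruct (Req_dec m 1) as [<-|Hm']; [exact Em|].
  set (u := Rmin 1 (m + d / 2)).
  assert (Hu1 : u <= 1) by apply Rmin_l.
  assert (Hu2 : u <= m + d / 2) by apply Rmin_r.
  assert (Hu3 : m < u) by (apply Rmin_glb_lt; lra).
  assert (Eu : E u).
  { split; [lra|]. apply Htrans with m; [exact Em|]. apply H; [lra|].
    rewrite Rabs_pos_eq; lra. }
  pose proof (Hm1 u Eu). lra.
Qed.

Lemma is_derive_Im_seg (F : C -> C) (a b : C) (t : R) (l : C) :
  cderiv F (seg a b t) l ->
  is_derive (fun s => Im (F (seg a b s))) t (Im ((b - a) * l)%C).
Proof.
  intros [q [<- [Cq HF]]].
  apply (is_derive_slope R_NormedModule (fun s => Im (F (seg a b s)))
           (fun s => Im ((b - a) * q (seg a b s))%C)).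
  - apply continuous_Im. apply continuous_Cmult; [apply continuous_const|].
    apply (continuous_comp (seg a b) q); [apply continuous_seg|exact Cq].
  - intros s. rewrite (HF (seg a b s)).
    match goal with |- ?l = plus ?x (scal ?c ?y) => change (l = x + c * y) end.
    rewrite <- im_scal_l, <- im_plus. f_equal. unfold seg.
    rewrite RtoC_minus. ring.
Qed.

(** If [u 0 = 1] then the differential form [u z / z dz] has residue [1] at [0],
    so that the exponential [E] of its integral is single valued: it is
    [z exp (- K z)] with [K] a primitive of [(1 - u z) / z].  It moves little where
    [u] is small, and it maps into itself each ray on which [u] is real. *)
Lemma exp_log_primitive (u : C -> C) :
  differentiable_on_disk u -> u 0%C = 1%C ->
  exists E : C -> C,
    (forall z, disk z -> z <> 0%C -> cderiv E z (E z * (u z / z))%C) /\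
    (forall v : C, Cmod v = 1 ->
       (forall t, 0 <= t < 1 -> Im (u (RtoC t * v)%C) = 0) ->
       forall r, 0 < r < 1 ->
         exists rho, 0 < rho /\ E (RtoC r * v)%C = (RtoC rho * v)%C).
Proof.
  intros Hu Hu0.
  destruct (Hu 0%C disk_0) as [l0 [q [_ [Cq Hq]]]].
  set (k := fun y => (- q y)%C).
  assert (Hk : forall y : C, y <> 0%C -> k y = ((1 - u y) / y)%C).
  { intros y Hy. unfold k. rewrite (Hq y), Hu0. field. exact Hy. }
  assert (Dk : forall y : C, disk y -> y <> 0%C -> exists l, cderiv k y l).
  { intros y Hy Hy0. destruct (Hu y Hy) as [l Hl].
    eexists. apply cderiv_ext_loc with (f := fun x : C => ((1 - u x) / x)%C)
      (r := Cmod y).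
    - now apply Cmod_gt_0.
    - intros x Hx. symmetry. apply Hk. intros ->.
      replace (0 - y)%C with (- y)%C in Hx by ring. rewrite Cmod_opp in Hx. lra.
    - apply (cderiv_div (fun x => 1 - u x)%C (fun x => x)); [|apply cderiv_id|exact Hy0].
      apply (cderiv_minus (fun _ => 1%C) u); [apply cderiv_const|exact Hl]. }
  assert (Ck : forall y, disk y -> continuous k y).
  { intros y Hy. destruct (Ceq_dec y 0) as [->|N].
    - now apply continuous_Copp.
    - destruct (Dk y Hy N) as [l Hl]. exact (cderiv_continuous _ _ _ Hl). }
  destruct (primitive_on_disk k Ck Dk) as [K [K0 HK]].
  exists (fun z => (z * Cexp (- K z))%C). split.
  - intros z Hz Hz0.
    apply cderiv_eq with (1 * Cexp (- K z) + z * (Cexp (- K z) * - k z))%C.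
    + apply (cderiv_mult (fun z => z) (fun z => Cexp (- K z))).
      * apply cderiv_id.
      * apply (cderiv_comp Cexp (fun z => - K z)%C).
        -- apply cderiv_Cexp.
        -- now apply cderiv_opp, HK.
    + rewrite (Hk z Hz0). field. exact Hz0.
  - (* [K] is real on a ray where [u] is, since its derivative along the ray is
       [(1 - u) / t]. *)
    intros v Hv Hreal r Hr.
    assert (Hin : forall t, 0 <= t <= 1 -> disk (seg 0 (RtoC r * v) t)).
    { intros t Ht. apply seg_in_disk; [apply disk_0| |exact Ht].
      unfold disk. rewrite Cmod_mult, Cmod_R, Rabs_pos_eq, Hv by lra. lra. }
    assert (Hseg : forall t, seg 0 (RtoC r * v) t = (RtoC (t * r) * v)%C)
      by (intros t; unfold seg; rewrite RtoC_mult; ring).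
    assert (HIm : Im (K (RtoC r * v)%C) = 0).
    { assert (HD : forall t, 0 <= t <= 1 ->
        is_derive (fun s => Im (K (seg 0 (RtoC r * v) s))) t
          (Im ((RtoC r * v - 0) * k (seg 0 (RtoC r * v) t))%C)).
      { intros t Ht. now apply is_derive_Im_seg, HK, Hin. }
      destruct (MVT_gen (fun s => Im (K (seg 0 (RtoC r * v) s))) 0 1
        (fun _ => 0)) as [c [_ Ec]].
      - intros t Ht. rewrite Rmin_left, Rmax_right in Ht by lra.
        pose proof (HD t ltac:(lra)) as HDt.
        match type of HDt with is_derive _ _ ?l => assert (El : l = 0) end;
          [|rewrite El in HDt; exact HDt].
        assert (Hv0 : v <> 0%C) by (apply Cmod_gt_0; lra).
        assert (Hr0 : RtoC r <> 0%C) by (apply RtoC_neq_0; lra).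
        assert (Ht0 : RtoC t <> 0%C) by (apply RtoC_neq_0; lra).
        rewrite Hseg, RtoC_mult, Hk by now repeat apply Cmult_neq_0.
        replace ((RtoC r * v - 0) * ((1 - u (RtoC t * RtoC r * v))
                 / (RtoC t * RtoC r * v)))%C
          with (RtoC (/ t) * (1 - u (RtoC (t * r) * v)))%C
          by (rewrite RtoC_inv, RtoC_mult by lra; field; now repeat split).
        rewrite im_scal_l. unfold Cminus. rewrite im_plus, im_opp, Hreal by nra.
        simpl. ring.
      - intros t Ht. rewrite Rmin_left, Rmax_right in Ht by lra.
        apply continuity_pt_filterlim.
        apply (ex_derive_continuous (V := R_NormedModule)).
        eexists. now apply HD.
      - rewrite seg_0, seg_1, K0 in Ec. simpl in Ec. lra. }
    exists (r * exp (Re (- K (RtoC r * v)%C))). split.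
    + apply Rmult_lt_0_compat; [lra|apply exp_pos].
    + rewrite Cexp_real by (rewrite im_opp, HIm; ring).
      rewrite RtoC_mult. ring.
Qed.

(** Where [u] is less than [1] in modulus, large powers [u ^ m] make the
    functions of the preceding lemma locally almost constant; this comparison of
    two points is an equivalence relation. *)
Definition asymptotically_equal (E : nat -> C -> C) (z w : C) : Prop :=
  forall eps, 0 < eps -> exists N, forall m, (N <= m)%nat ->
    Cmod (E m w - E m z) <= eps * Cmod (E m z).

Lemma asymptotically_equal_sym (E : nat -> C -> C) (z w : C) :
  asymptotically_equal E z w -> asymptotically_equal E w z.
Proof.
  intros H eps Heps.
  destruct (H (Rmin (1 / 2) (eps / 2))) as [N HN].
  { apply Rmin_glb_lt; lra. }
  exists N. intros m Hm. specialize (HN m Hm).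
  pose proof (Rmin_l (1 / 2) (eps / 2)). pose proof (Rmin_r (1 / 2) (eps / 2)).
  pose proof (Cmod_reverse_triangle (E m z) (E m w)).
  rewrite (Cmod_minus_sym (E m z)) in *.
  pose proof (Cmod_ge_0 (E m z)).
  assert (Cmod (E m z) <= 2 * Cmod (E m w)) by nra.
  apply Rle_trans with (1 := HN). nra.
Qed.

Lemma asymptotically_equal_trans (E : nat -> C -> C) (z w v : C) :
  asymptotically_equal E z w -> asymptotically_equal E w v ->
  asymptotically_equal E z v.
Proof.
  intros H1 H2 eps Heps.
  set (e := Rmin 1 (eps / 3)).
  assert (He : 0 < e) by (apply Rmin_glb_lt; lra).
  assert (He1 : e <= 1) by apply Rmin_l.
  assert (He2 : e <= eps / 3) by apply Rmin_r.
  destruct (H1 e He) as [N1 HN1]. destruct (H2 e He) as [N2 HN2].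
  exists (N1 + N2)%nat. intros m Hm.
  specialize (HN1 m ltac:(lia)). specialize (HN2 m ltac:(lia)).
  pose proof (Cmod_reverse_triangle (E m w) (E m z)).
  pose proof (Cmod_ge_0 (E m z)).
  replace (E m v - E m z)%C with ((E m v - E m w) + (E m w - E m z))%C by ring.
  apply Rle_trans with (1 := Cmod_triangle _ _).
  assert (Cmod (E m w) <= 2 * Cmod (E m z)) by nra.
  assert (e * Cmod (E m w) <= e * (2 * Cmod (E m z)))
    by (apply Rmult_le_compat_l; lra).
  nra.
Qed.

Lemma pow_eventually_small (theta eps : R) :
  0 <= theta < 1 -> 0 < eps ->
  exists N, forall m, (N <= m)%nat -> theta ^ m <= eps.
Proof.
  intros Ht Heps.
  destruct (pow_lt_1_zero theta ltac:(rewrite Rabs_pos_eq; lra) eps Heps)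
    as [N HN].
  exists N. intros m Hm. specialize (HN m Hm). apply Rle_trans with (1 := Rle_abs _).
  lra.
Qed.

(** The maximum [M] of [|E|] on the segment satisfies [M <= |E z| + eta M]: this
    bounds the logarithmic variation without a logarithm. *)
Lemma log_derivative_estimate (E e : C -> C) (z w : C) (eta : R) :
  eta <= 1 / 2 ->
  (forall t, 0 <= t <= 1 ->
     cderiv E (seg z w t) (E (seg z w t) * e (seg z w t))%C) ->
  (forall t, 0 <= t <= 1 -> Cmod (e (seg z w t)) * Cmod (w - z) <= eta) ->
  Cmod (E w - E z) <= 2 * eta * Cmod (E z).
Proof.
  intros Heta HE He.
  assert (Heta0 : 0 <= eta).
  { apply Rle_trans with (2 := He 0 ltac:(lra)).
    apply Rmult_le_pos; apply Cmod_ge_0. }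
  destruct (Req_dec (Cmod (w - z)) 0) as [E0|N].
  { apply Cmod_eq_0, Ceq_minus in E0. rewrite E0, Cminus_diag, Cmod_0.
    pose proof (Cmod_ge_0 (E z)). nra. }
  pose proof (Cmod_ge_0 (w - z)) as Hwz.
  destruct (continuity_ab_maj (fun t => Cmod (E (seg z w t))) 0 1) as [s [Hs Hs1]].
  { lra. }
  { intros t Ht. apply continuity_pt_filterlim.
    apply (continuous_Cmod _ (fun t => E (seg z w t))).
    apply (continuous_comp (seg z w) E); [apply continuous_seg|].
    exact (cderiv_continuous _ _ _ (HE t Ht)). }
  set (M := Cmod (E (seg z w s))) in *.
  assert (Hgen : forall t, 0 <= t <= 1 -> Cmod (E (seg z w t) - E z) <= eta * M).
  { intros t Ht.
    apply Rle_trans with (M * (eta / Cmod (w - z)) * Cmod (seg z w t - z)).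
    - apply cderiv_mean_value with (f := fun y => (E y * e y)%C).
      + intros r Hr. replace (seg z (seg z w t) r) with (seg z w (r * t))
          by (unfold seg; rewrite RtoC_mult; ring).
        apply HE. nra.
      + intros r Hr. replace (seg z (seg z w t) r) with (seg z w (r * t))
          by (unfold seg; rewrite RtoC_mult; ring).
        assert (Hrt : 0 <= r * t <= 1) by nra.
        rewrite Cmod_mult. apply Rmult_le_compat; try apply Cmod_ge_0.
        * now apply Hs.
        * apply Rmult_le_reg_r with (Cmod (w - z)); [lra|].
          unfold Rdiv. rewrite Rmult_assoc, Rinv_l, Rmult_1_r by lra.
          now apply He.
    - replace (seg z w t - z)%C with (RtoC t * (w - z))%C by (unfold seg; ring).
      rewrite Cmod_mult, Cmod_R, Rabs_pos_eq by lra.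
      replace (M * (eta / Cmod (w - z)) * (t * Cmod (w - z)))
        with (t * (eta * M)) by (field; lra).
      assert (0 <= eta * M) by (apply Rmult_le_pos; [lra|apply Cmod_ge_0]).
      nra. }
  assert (HM : M <= 2 * Cmod (E z)).
  { pose proof (Hgen s Hs1) as H.
    pose proof (Cmod_reverse_triangle (E (seg z w s)) (E z)) as H'.
    fold M in H'. assert (0 <= M) by apply Cmod_ge_0. nra. }
  pose proof (Hgen 1 ltac:(lra)) as H. rewrite seg_1 in H.
  apply Rle_trans with (1 := H). nra.
Qed.

Lemma ray_distance (v : C) :
  Cmod v = 1 -> v <> 1%C -> exists c, 0 < c /\
    forall r s, 0 < r -> 0 < s -> c * r <= Cmod (RtoC s * v - RtoC r).
Proof.
  intros Hv Hv1.
  destruct (Req_dec (Im v) 0) as [E0|N].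
  - exists 1. split; [lra|]. intros r' s' Hr Hs.
    assert (Hre : Re v = -1).
    { pose proof (Cmod2_alt v) as H2. rewrite Hv, E0 in H2.
      assert (Hx : (Re v - 1) * (Re v + 1) = 0) by (simpl in H2; lra).
      apply Rmult_integral in Hx. destruct Hx as [Hx|Hx]; [|lra].
      elim Hv1. destruct v as [x y]. simpl in *. unfold RtoC. f_equal; lra. }
    apply Rle_trans with (2 := re_le_Cmod _).
    unfold Cminus. rewrite re_plus, re_scal_l, Hre, re_opp. simpl.
    rewrite Rabs_left1; lra.
  - exists (Rabs (Im v)). split; [now apply Rabs_pos_lt|]. intros r' s' Hr Hs.
    replace (Cmod (RtoC s' * v - RtoC r')) with (Cmod (Cconj v * (RtoC s' * v - RtoC r')))
      by (rewrite Cmod_mult, Cmod_conj, Hv; ring).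
    apply Rle_trans with (2 := im_le_Cmod _).
    right. rewrite <- (Rabs_pos_eq r') at 1 by lra. rewrite <- Rabs_mult.
    f_equal. destruct v as [x y]. simpl. ring.
Qed.

(** If [|g| < |g 0|] along the path, then the functions [E] attached to the powers
    of [g / g 0] take almost equal values at both ends; but one of these values
    lies on the positive axis and the other on the ray through [v].  This replaces
    a winding number: the path may leave the sector between the two rays. *)
Theorem maximum_principle_between_rays (g : C -> C) (v : C) (gamma : R -> C)
    (r s : R) :
  differentiable_on_disk g -> g 0%C <> 0%C ->
  Cmod v = 1 -> v <> 1%C ->
  (forall t, 0 <= t < 1 -> Im (g (RtoC t) / g 0%C)%C = 0) ->
  (forall t, 0 <= t < 1 -> Im (g (RtoC t * v) / g 0%C)%C = 0) ->
  (forall t, 0 <= t <= 1 -> disk (gamma t) /\ continuous gamma t) ->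
  0 < r -> 0 < s -> gamma 0 = RtoC r -> gamma 1 = (RtoC s * v)%C ->
  exists t, 0 <= t <= 1 /\ Cmod (g 0%C) <= Cmod (g (gamma t)).
Proof.
  intros Hg Hg0 Hv Hv1 Hreal1 Hreal2 Hgamma Hr Hs G0 G1.
  apply NNPP. intros Hno.
  assert (Hlt : forall t, 0 <= t <= 1 -> Cmod (g (gamma t)) < Cmod (g 0%C)).
  { intros t Ht. apply Rnot_le_lt. intros H. apply Hno. now exists t. }
  pose proof (proj1 (Cmod_gt_0 _) Hg0) as Hg0p.
  set (u := fun (m : nat) z => ((g z / g 0%C) ^ m)%C).
  assert (Du1 : differentiable_on_disk (fun z => g z / g 0%C)%C).
  { intros z Hz. destruct (Hg z Hz) as [l Hl].
    eexists. apply (cderiv_div g (fun _ => g 0%C)); [exact Hl| |exact Hg0].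
    apply cderiv_const. }
  assert (Du : forall m, differentiable_on_disk (u m)).
  { intros m z Hz. destruct (Du1 z Hz) as [l Hl].
    exact (cderiv_pow _ m _ _ Hl). }
  assert (Hpow : forall (z : C) m, Im z = 0 -> Im (z ^ m)%C = 0).
  { intros z m Hz. induction m as [|m IH]; [reflexivity|].
    rewrite Cpow_S, im_mult, IH, Hz. ring. }
  assert (HE : forall m, exists E : C -> C,
    (forall z, disk z -> z <> 0%C -> cderiv E z (E z * (u m z / z))%C) /\
    (forall w : C, Cmod w = 1 ->
       (forall t, 0 <= t < 1 -> Im (u m (RtoC t * w)%C) = 0) ->
       forall r, 0 < r < 1 ->
         exists rho, 0 < rho /\ E (RtoC r * w)%C = (RtoC rho * w)%C)).
  { intros m. apply exp_log_primitive; [apply Du|].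
    unfold u. replace (g 0%C / g 0%C)%C with (RtoC 1) by (field; exact Hg0).
    apply Cpow_1_l. }
  set (E := fun m => proj1_sig (constructive_indefinite_description _ (HE m))).
  assert (HEm : forall m,
    (forall z, disk z -> z <> 0%C -> cderiv (E m) z (E m z * (u m z / z))%C) /\
    (forall w : C, Cmod w = 1 ->
       (forall t, 0 <= t < 1 -> Im (u m (RtoC t * w)%C) = 0) ->
       forall r, 0 < r < 1 ->
         exists rho, 0 < rho /\ E m (RtoC r * w)%C = (RtoC rho * w)%C)).
  { intros m. exact (proj2_sig (constructive_indefinite_description _ (HE m))). }
  clearbody E. clear HE.
  assert (Hequiv : asymptotically_equal E (gamma 0) (gamma 1)).
  { apply (path_equivalence
             (fun t t' => asymptotically_equal E (gamma t) (gamma t'))).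
    - intros. now apply asymptotically_equal_sym.
    - intros. now apply asymptotically_equal_trans with (gamma t).
    - intros t Ht. destruct (Hgamma t Ht) as [Hd Hc].
      set (z := gamma t) in *.
      assert (Hz0 : z <> 0%C).
      { intros Ez. pose proof (Hlt t Ht) as H. fold z in H. rewrite Ez in H. lra. }
      pose proof (proj1 (Cmod_gt_0 z) Hz0) as Hzp.
      pose proof (Hlt t Ht) as Hltz. fold z in Hltz. unfold disk in Hd.
      set (c := (Cmod (g 0%C) - Cmod (g z)) / 2).
      assert (Hc0 : 0 < c) by (unfold c; lra).
      destruct (proj1 (continuous_C_C g z) (differentiable_continuous g z Hg Hd) c Hc0)
        as [d1 [Hd1 Hg1]].
      set (d := Rmin d1 (Rmin (1 - Cmod z) (Cmod z / 2))).
      assert (Hd0 : 0 < d) by (repeat apply Rmin_glb_lt; lra).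
      assert (L1 : d <= d1) by apply Rmin_l.
      assert (L2 : d <= 1 - Cmod z)
        by (unfold d; apply Rle_trans with (1 := Rmin_r _ _); apply Rmin_l).
      assert (L3 : d <= Cmod z / 2)
        by (unfold d; apply Rle_trans with (1 := Rmin_r _ _); apply Rmin_r).
      destruct (proj1 (continuous_R_C gamma t) Hc d Hd0) as [e [He Hge]].
      exists e. split; [exact He|]. intros t' _ Ht'.
      pose proof (Hge t' Ht') as Hw. fold z in Hw. set (w := gamma t') in *.
      set (theta := (Cmod (g z) + c) / Cmod (g 0%C)).
      assert (Hth : 0 <= theta < 1).
      { split.
        - apply Rmult_le_pos; [|left; now apply Rinv_0_lt_compat].
          pose proof (Cmod_ge_0 (g z)). lra.
        - apply Rmult_lt_reg_r with (Cmod (g 0%C)); [exact Hg0p|].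
          unfold theta, Rdiv. rewrite Rmult_assoc, Rinv_l by lra.
          unfold c. lra. }
      intros eps Heps.
      set (eps' := Rmin (1 / 2) (eps / 2)).
      assert (Heps' : 0 < eps') by (apply Rmin_glb_lt; lra).
      destruct (pow_eventually_small theta eps' Hth Heps') as [N HN].
      exists N. intros m Hm. specialize (HN m Hm).
      apply Rle_trans with (2 * eps' * Cmod (E m z)).
      2: { apply Rmult_le_compat_r; [apply Cmod_ge_0|].
           pose proof (Rmin_r (1 / 2) (eps / 2)). unfold eps'. lra. }
      apply log_derivative_estimate with (e := fun y => (u m y / y)%C).
      { apply Rmin_l. }
      { intros a Ha. apply HEm.
        - apply seg_in_disk; [exact Hd| |exact Ha].
          pose proof (Cmod_reverse_triangle w z). unfold disk. lra.
        - intros E0.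
          assert (Hb : Cmod (seg z w a - z) <= Cmod (w - z)).
          { replace (seg z w a - z)%C with (RtoC a * (w - z))%C
              by (unfold seg; ring).
            rewrite Cmod_mult, Cmod_R, Rabs_pos_eq by lra.
            pose proof (Cmod_ge_0 (w - z)). nra. }
          rewrite E0 in Hb. replace (0 - z)%C with (- z)%C in Hb by ring.
          rewrite Cmod_opp in Hb. lra. }
      intros a Ha. set (y := seg z w a).
      assert (Hb : Cmod (y - z) < d).
      { apply Rle_lt_trans with (2 := Hw). unfold y.
        replace (seg z w a - z)%C with (RtoC a * (w - z))%C
          by (unfold seg; ring).
        rewrite Cmod_mult, Cmod_R, Rabs_pos_eq by lra.
        pose proof (Cmod_ge_0 (w - z)). nra. }
      pose proof (Cmod_reverse_triangle z y) as Hyz.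
      rewrite (Cmod_minus_sym z) in Hyz.
      assert (Hy0 : y <> 0%C) by (apply Cmod_gt_0; lra).
      rewrite Cmod_div by exact Hy0. unfold u. rewrite Cmod_pow.
      assert (Hgy : Cmod (g y / g 0%C) <= theta).
      { rewrite Cmod_div by exact Hg0. apply Rmult_le_compat_r.
        - left. now apply Rinv_0_lt_compat.
        - pose proof (Cmod_reverse_triangle (g y) (g z)).
          pose proof (Hg1 y ltac:(lra)). lra. }
      assert (Hp : Cmod (g y / g 0%C) ^ m <= theta ^ m).
      { apply pow_incr. split; [apply Cmod_ge_0|exact Hgy]. }
      assert (Hp0 : 0 <= Cmod (g y / g 0%C) ^ m) by apply pow_le, Cmod_ge_0.
      apply Rmult_le_reg_r with (Cmod y); [lra|].
      unfold Rdiv.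
      replace (Cmod (g y / g 0%C) ^ m * / Cmod y * Cmod (w - z) * Cmod y)
        with (Cmod (g y / g 0%C) ^ m * Cmod (w - z)) by (field; lra).
      apply Rmult_le_compat; [exact Hp0|apply Cmod_ge_0|lra|lra]. }
  rewrite G0, G1 in Hequiv.
  destruct (ray_distance v Hv Hv1) as [c [Hc Hdist]].
  destruct (Hequiv (c / 2)) as [N HN]; [lra|].
  specialize (HN N (le_n N)).
  assert (Hr1 : r < 1).
  { pose proof (proj1 (Hgamma 0 ltac:(lra))) as H. rewrite G0 in H.
    unfold disk in H. rewrite Cmod_R, Rabs_pos_eq in H; lra. }
  assert (Hs1 : s < 1).
  { pose proof (proj1 (Hgamma 1 ltac:(lra))) as H. rewrite G1 in H.
    unfold disk in H. rewrite Cmod_mult, Cmod_R, Rabs_pos_eq, Hv in H; lra. }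
  destruct (HEm N) as [_ HEN].
  destruct (HEN 1%C) with (r := r) as [rho [Hrho Er]].
  { apply Cmod_1. }
  { intros t Ht. unfold u. apply Hpow. rewrite Cmult_1_r. now apply Hreal1. }
  { lra. }
  destruct (HEN v Hv) with (r := s) as [sigma [Hsigma Es]].
  { intros t Ht. unfold u. apply Hpow. now apply Hreal2. }
  { lra. }
  rewrite !Cmult_1_r in Er. rewrite Er, Es in HN.
  rewrite Cmod_R, (Rabs_pos_eq rho) in HN by lra.
  pose proof (Hdist rho sigma Hrho Hsigma). nra.
Qed.

(** * Symmetrisation and the estimate at the vertex of an angle *)

Definition bounded_by_1_on_disk (f : C -> C) : Prop :=
  forall z, disk z -> Cmod (f z) <= 1.

Fixpoint rotation_product (f : C -> C) (w : C) (n : nat) (z : C) : C :=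
  match n with
  | O => 1%C
  | S m => (rotation_product f w m z * f (w ^ m * z))%C
  end.

Lemma rotation_product_shift (f : C -> C) (w z : C) (n : nat) :
  rotation_product f w (S n) z = (f z * rotation_product f w n (w * z))%C.
Proof.
  induction n as [|n IH].
  - simpl. replace (1 * z)%C with z by ring. ring.
  - change (rotation_product f w (S n) z * f (w ^ S n * z)
      = f z * (rotation_product f w n (w * z) * f (w ^ n * (w * z))))%C.
    rewrite IH, Cpow_S. replace (w ^ n * (w * z))%C with (w * w ^ n * z)%C by ring.
    ring.
Qed.

Lemma rotation_product_invariant (f : C -> C) (w z : C) (n : nat) :
  (w ^ n)%C = 1%C ->
  rotation_product f w n (w * z) = rotation_product f w n z.
Proof.
  destruct n as [|n]; intros Hw; [reflexivity|].
  rewrite (rotation_product_shift f w z n). simpl.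
  replace (w ^ n * (w * z))%C with z.
  - ring.
  - rewrite Cmult_assoc, (Cmult_comm (w ^ n)), <- Cpow_S, Hw. ring.
Qed.

Lemma rotation_product_at_0 (f : C -> C) (w : C) (n : nat) :
  rotation_product f w n 0 = (f 0%C ^ n)%C.
Proof.
  induction n as [|n IH]; [reflexivity|].
  simpl. rewrite IH, Cmult_0_r. ring.
Qed.

Lemma disk_rotation (w z : C) : Cmod w = 1 -> disk z -> disk (w * z).
Proof. unfold disk. intros Hw Hz. rewrite Cmod_mult, Hw. lra. Qed.

Lemma Cmod_pow_1 (w : C) (n : nat) : Cmod w = 1 -> Cmod (w ^ n) = 1.
Proof. intros Hw. rewrite Cmod_pow, Hw. apply pow1. Qed.

Lemma differentiable_scale (f : C -> C) (w : C) :
  Cmod w = 1 -> differentiable_on_disk f ->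
  differentiable_on_disk (fun z => f (w * z)%C).
Proof.
  intros Hw Hf z Hz. destruct (Hf (w * z)%C) as [l Hl].
  { now apply disk_rotation. }
  eexists. apply (cderiv_comp f (fun z => w * z)%C); [exact Hl|].
  apply (cderiv_mult (fun _ => w) (fun z => z)); [apply cderiv_const|apply cderiv_id].
Qed.

Lemma differentiable_mult (f g : C -> C) :
  differentiable_on_disk f -> differentiable_on_disk g ->
  differentiable_on_disk (fun z => f z * g z)%C.
Proof.
  intros Hf Hg z Hz. destruct (Hf z Hz) as [l Hl]. destruct (Hg z Hz) as [m Hm].
  eexists. apply cderiv_mult; eassumption.
Qed.

Lemma differentiable_rotation_product (f : C -> C) (w : C) (n : nat) :
  Cmod w = 1 -> differentiable_on_disk f ->
  differentiable_on_disk (rotation_product f w n).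
Proof.
  intros Hw Hf. induction n as [|n IH].
  - intros z _. exists 0%C. apply cderiv_const.
  - apply (differentiable_mult (rotation_product f w n) (fun z => f (w ^ n * z)%C));
      [exact IH|].
    apply differentiable_scale; [now apply Cmod_pow_1|exact Hf].
Qed.

Lemma rotation_product_bound (f : C -> C) (w : C) (n : nat) :
  Cmod w = 1 -> bounded_by_1_on_disk f ->
  bounded_by_1_on_disk (rotation_product f w n).
Proof.
  intros Hw Hf z Hz. induction n as [|n IH]; simpl.
  - rewrite Cmod_1. apply Rle_refl.
  - rewrite Cmod_mult. rewrite <- (Rmult_1_l 1).
    apply Rmult_le_compat; try apply Cmod_ge_0; [exact IH|].
    apply Hf. apply disk_rotation; [now apply Cmod_pow_1|exact Hz].
Qed.

Lemma disk_conj (z : C) : disk z -> disk (Cconj z).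
Proof. unfold disk. now rewrite Cmod_conj. Qed.

Lemma differentiable_conj (f : C -> C) :
  differentiable_on_disk f ->
  differentiable_on_disk (fun z => Cconj (f (Cconj z))).
Proof.
  intros Hf z Hz. destruct (Hf (Cconj z) (disk_conj z Hz)) as [l [q [Eq [Cq Hq]]]].
  exists (Cconj l). exists (fun y => Cconj (q (Cconj y))).
  split; [now rewrite Eq|]. split.
  - apply continuous_Cconj. apply (continuous_comp Cconj q); [|exact Cq].
    apply continuous_Cconj, continuous_id.
  - intros y. rewrite (Hq (Cconj y)), Cplus_conj, Cmult_conj, Cminus_conj, !Cconj_conj.
    reflexivity.
Qed.

Lemma Cconj_inverse_of_unit (v : C) : Cmod v = 1 -> (v * Cconj v)%C = 1%C.
Proof.
  intros Hv. rewrite <- Cmod2_conj, Hv. unfold RtoC. f_equal. ring.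
Qed.

(** The maximum principle is applied to the product [g] of the values of [f] at
    the images of [z] under the dihedral group generated by the reflections in the
    two rays, the values at orientation reversing images being conjugated.  It is
    real on both rays, it equals [|f 0| ^ (2 k)] at [0], and on the path it is at
    most [delta] because all its factors but one are at most [1]. *)
Lemma sector_estimate (f : C -> C) (v : C) (k : nat) (gamma : R -> C)
    (r s delta : R) :
  differentiable_on_disk f -> bounded_by_1_on_disk f ->
  (1 <= k)%nat -> Cmod v = 1 -> v <> 1%C -> (v ^ (2 * k))%C = 1%C ->
  (forall t, 0 <= t <= 1 ->
     disk (gamma t) /\ continuous gamma t /\ Cmod (f (gamma t)) <= delta) ->
  0 < r -> 0 < s -> gamma 0 = RtoC r -> gamma 1 = (RtoC s * v)%C ->
  Cmod (f 0%C) ^ (2 * k) <= delta.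
Proof.
  intros Df Bf Hk Hv Hv1 Hvk Hgamma Hr Hs G0 G1.
  destruct (Ceq_dec (f 0%C) 0) as [Z|NZ].
  { rewrite Z, Cmod_0, pow_i by lia.
    apply Rle_trans with (2 := proj2 (proj2 (Hgamma 0 ltac:(lra)))).
    apply Cmod_ge_0. }
  (* [w] generates the rotations of the dihedral group. *)
  set (w := (v * v)%C).
  assert (Hw : Cmod w = 1) by (unfold w; rewrite Cmod_mult, Hv; ring).
  assert (Hwk : (w ^ k)%C = 1%C).
  { rewrite <- Hvk, Cpow_mult_r. f_equal. simpl. unfold w. ring. }
  set (P := rotation_product f w k).
  set (g := fun z => (P z * Cconj (P (Cconj z)))%C).
  assert (DP : differentiable_on_disk P) by now apply differentiable_rotation_product.
  assert (BP : bounded_by_1_on_disk P) by now apply rotation_product_bound.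
  assert (Dg : differentiable_on_disk g).
  { apply (differentiable_mult P (fun z => Cconj (P (Cconj z)))); [exact DP|].
    now apply differentiable_conj. }
  assert (Econj : forall z, (z * Cconj z)%C = RtoC (Cmod z ^ 2))
    by (intros z; symmetry; apply Cmod2_conj).
  assert (Eg0 : g 0%C = RtoC (Cmod (f 0%C) ^ (2 * k))).
  { unfold g. replace (Cconj 0) with (RtoC 0) by (unfold Cconj, RtoC; simpl; f_equal; ring).
    rewrite Econj. unfold P. rewrite rotation_product_at_0, Cmod_pow.
    f_equal. rewrite <- pow_mult. f_equal. lia. }
  assert (Hfp : 0 < Cmod (f 0%C)) by now apply Cmod_gt_0.
  assert (Hg0p : 0 < Cmod (f 0%C) ^ (2 * k)) by now apply pow_lt.
  assert (Hg0 : g 0%C <> 0%C) by (rewrite Eg0; apply RtoC_neq_0; lra).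
  assert (Hreal : forall x c, Im (RtoC x / RtoC c)%C = 0 \/ c = 0).
  { intros x c. destruct (Req_dec c 0) as [E|N]; [now right|left].
    rewrite <- RtoC_div by exact N. reflexivity. }
  destruct (maximum_principle_between_rays g v gamma r s) as [t [Ht Hgt]];
    try assumption.
  - intros t Ht. unfold g.
    replace (Cconj (RtoC t)) with (RtoC t) by (unfold Cconj, RtoC; simpl; f_equal; ring).
    rewrite Econj. fold (g 0%C). rewrite Eg0.
    destruct (Hreal (Cmod (P (RtoC t)) ^ 2) (Cmod (f 0%C) ^ (2 * k))); [easy|lra].
  - intros t Ht. unfold g. fold (g 0%C).
    replace (P (Cconj (RtoC t * v))) with (P (RtoC t * v)%C).
    + rewrite Econj, Eg0.
      destruct (Hreal (Cmod (P (RtoC t * v)%C) ^ 2) (Cmod (f 0%C) ^ (2 * k)));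
        [easy|lra].
    + rewrite Cmult_conj.
      replace (Cconj (RtoC t)) with (RtoC t)
        by (unfold Cconj, RtoC; simpl; f_equal; ring).
      unfold P. rewrite <- (rotation_product_invariant f w (RtoC t * Cconj v) k Hwk).
      f_equal. unfold w.
      replace (v * v * (RtoC t * Cconj v))%C with (RtoC t * v * (v * Cconj v))%C by ring.
      rewrite Cconj_inverse_of_unit by exact Hv. ring.
  - intros t Ht. split; now apply Hgamma.
  - rewrite Eg0, Cmod_R, Rabs_pos_eq in Hgt by lra.
    apply Rle_trans with (1 := Hgt).
    destruct (Hgamma t Ht) as [Hd [_ Hfd]].
    apply Rle_trans with (2 := Hfd).
    unfold g. rewrite Cmod_mult, Cmod_conj.
    pose proof (BP _ (disk_conj _ Hd)) as B2.
    pose proof (Cmod_ge_0 (f (gamma t))).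
    assert (B1 : Cmod (P (gamma t)) <= Cmod (f (gamma t))).
    { unfold P. destruct k as [|k']; [lia|].
      rewrite rotation_product_shift, Cmod_mult.
      pose proof (rotation_product_bound f w k' Hw Bf (w * gamma t)%C
                    (disk_rotation w _ Hw Hd)).
      pose proof (Cmod_ge_0 (rotation_product f w k' (w * gamma t)%C)). nra. }
    pose proof (Cmod_ge_0 (P (gamma t))).
    pose proof (Cmod_ge_0 (P (Cconj (gamma t)))). nra.
Qed.

Lemma de_moivre (x : R) (n : nat) :
  ((cos x, sin x) ^ n)%C = (cos (INR n * x), sin (INR n * x)).
Proof.
  induction n as [|n IH].
  - simpl. rewrite Rmult_0_l, cos_0, sin_0. reflexivity.
  - rewrite Cpow_S, IH, S_INR, Rmult_plus_distr_r, Rmult_1_l, Rplus_comm.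
    rewrite cos_plus, sin_plus. unfold Cmult; simpl. f_equal; ring.
Qed.

Lemma root_of_unity_of_Re (v : C) (k : nat) :
  (1 <= k)%nat -> Cmod v = 1 -> Re v = cos (PI / INR k) ->
  v <> 1%C /\ (v ^ (2 * k))%C = 1%C.
Proof.
  intros Hk Hv Hre.
  assert (HK : 1 <= INR k) by (apply (le_INR 1); exact Hk).
  pose proof PI_RGT_0 as Hpi.
  assert (Hx : 0 < PI / INR k <= PI).
  { split; [apply Rdiv_lt_0_compat; lra|].
    apply Rmult_le_reg_r with (INR k); [lra|].
    unfold Rdiv. rewrite Rmult_assoc, Rinv_l by lra. nra. }
  assert (HIm : Im v = sin (PI / INR k) \/ Im v = sin (- (PI / INR k))).
  { rewrite sin_neg. pose proof (Cmod2_alt v) as H2. rewrite Hv, Hre in H2.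
    pose proof (sin2_cos2 (PI / INR k)) as H3. unfold Rsqr in H3.
    assert (H4 : (Im v - sin (PI / INR k)) * (Im v + sin (PI / INR k)) = 0)
      by (simpl in H2; lra).
    apply Rmult_integral in H4. destruct H4; [left|right]; lra. }
  split.
  - intros E. rewrite E in Hre. simpl in Hre.
    assert (cos (PI / INR k) < cos 0) by (apply cos_decreasing_1; lra).
    rewrite cos_0 in H. lra.
  - assert (HE : exists x, v = (cos x, sin x) /\
      (INR (2 * k) * x = 2 * PI \/ INR (2 * k) * x = - (2 * PI))).
    { rewrite mult_INR. simpl (INR 2). destruct HIm as [H|H].
      - exists (PI / INR k). split.
        + destruct v. simpl in *. now rewrite Hre, H.
        + left. field. lra.
      - exists (- (PI / INR k)). split.
        + destruct v. simpl in *. now rewrite cos_neg, Hre, H.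
        + right. field. lra. }
    destruct HE as [x [-> [E|E]]]; rewrite de_moivre, E.
    + rewrite cos_2PI, sin_2PI. reflexivity.
    + rewrite cos_neg, sin_neg, cos_2PI, sin_2PI, Ropp_0. reflexivity.
Qed.

(** The hypothesis says that the ends of the path are seen from [0] at an angle of
    at least [PI / k].  By the intermediate value theorem the path then meets a ray
    making with the initial one an angle of exactly [PI / k]. *)
Theorem angle_estimate (f : C -> C) (k : nat) (gamma : R -> C) (delta : R) :
  differentiable_on_disk f -> bounded_by_1_on_disk f -> (1 <= k)%nat ->
  (forall t, 0 <= t <= 1 ->
     disk (gamma t) /\ continuous gamma t /\ Cmod (f (gamma t)) <= delta) ->
  Re (gamma 1 * Cconj (gamma 0))%C
    <= cos (PI / INR k) * (Cmod (gamma 1) * Cmod (gamma 0)) ->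
  Cmod (f 0%C) ^ (2 * k) <= delta.
Proof.
  intros Df Bf Hk Hgamma Hangle.
  (* A path through the vertex gives the estimate directly. *)
  destruct (classic (exists t, 0 <= t <= 1 /\ gamma t = 0%C)) as [[t [Ht E]]|N0].
  { destruct (Hgamma t Ht) as [_ [_ H]]. rewrite E in H.
    apply Rle_trans with (2 := H).
    pose proof (Bf 0%C disk_0) as B. pose proof (Cmod_ge_0 (f 0%C)) as B0.
    destruct k as [|k']; [lia|].
    replace (2 * S k')%nat with (S (S (2 * k')))%nat by lia.
    rewrite <- tech_pow_Rmult.
    assert (Cmod (f 0%C) ^ S (2 * k') <= 1); [|nra].
    rewrite <- (pow1 (S (2 * k'))). apply pow_incr. lra. }
  assert (Hnz : forall t, 0 <= t <= 1 -> gamma t <> 0%C).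
  { intros t Ht E. apply N0. now exists t. }
  set (a := gamma 0) in *.
  assert (Ha : a <> 0%C) by (apply Hnz; lra).
  pose proof (proj1 (Cmod_gt_0 a) Ha) as Hap.
  set (chi := fun t => cos (PI / INR k) * (Cmod (gamma t) * Cmod a)
                       - Re (gamma t * Cconj a)%C).
  assert (Cchi : forall t, 0 <= t <= 1 -> continuity_pt chi t).
  { intros t Ht. destruct (Hgamma t Ht) as [_ [Hc _]].
    apply continuity_pt_filterlim.
    apply (continuous_minus (V := R_NormedModule)).
    - apply (continuous_mult (K := R_AbsRing)); [apply continuous_const|].
      apply (continuous_mult (K := R_AbsRing)); [|apply continuous_const].
      now apply continuous_Cmod.
    - apply continuous_Re. apply continuous_Cmult; [exact Hc|apply continuous_const]. }
  assert (Hcos : cos (PI / INR k) < 1).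
  { assert (HK : 1 <= INR k) by (apply (le_INR 1); exact Hk).
    pose proof PI_RGT_0 as Hpi. rewrite <- cos_0.
    assert (0 < PI / INR k <= PI).
    { split; [apply Rdiv_lt_0_compat; lra|].
      apply Rmult_le_reg_r with (INR k); [lra|].
      unfold Rdiv. rewrite Rmult_assoc, Rinv_l by lra. nra. }
    apply cos_decreasing_1; lra. }
  assert (Hchi0 : chi 0 < 0).
  { unfold chi. fold a. rewrite <- Cmod2_conj. simpl.
    assert (0 < (1 - cos (PI / INR k)) * (Cmod a * Cmod a))
      by (apply Rmult_lt_0_compat; nra).
    lra. }
  assert (Hex : exists t1, 0 <= t1 <= 1 /\ chi t1 = 0).
  { destruct (Req_dec (chi 1) 0) as [E|N].
    - exists 1. split; [lra|exact E].
    - assert (Hchi1 : 0 < chi 1) by (unfold chi in *; lra).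
      destruct (Ranalysis5.IVT_interv chi 0 1 Cchi ltac:(lra) Hchi0 Hchi1) as [t1 [Ht1 E]].
      now exists t1. }
  destruct Hex as [t1 [Ht1 E1]].
  set (b := gamma t1) in *.
  assert (Hb : b <> 0%C) by now apply Hnz.
  pose proof (proj1 (Cmod_gt_0 b) Hb) as Hbp.
  (* Rotating by the direction [e] of [a] makes the path start on the positive
     axis. *)
  set (e := (a / RtoC (Cmod a))%C).
  assert (Ha' : RtoC (Cmod a) <> 0%C) by (apply RtoC_neq_0; lra).
  assert (Hb' : RtoC (Cmod b) <> 0%C) by (apply RtoC_neq_0; lra).
  assert (He : Cmod e = 1).
  { unfold e. rewrite Cmod_div, Cmod_R, Rabs_pos_eq by (trivial; lra).
    field. lra. }
  assert (He0 : e <> 0%C) by (apply Cmod_gt_0; lra).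
  set (v := (b / (RtoC (Cmod b) * e))%C).
  assert (Hv : Cmod v = 1).
  { unfold v. rewrite Cmod_div, Cmod_mult, Cmod_R, Rabs_pos_eq, He
      by (try apply Cmult_neq_0; trivial; lra). field. lra. }
  assert (Hre : Re v = cos (PI / INR k)).
  { assert (Ev : v = (RtoC (/ (Cmod b * Cmod a)) * (b * Cconj a))%C).
    { assert (Haa : (a * Cconj a)%C = (RtoC (Cmod a) * RtoC (Cmod a))%C).
      { rewrite <- Cmod2_conj, <- RtoC_mult. f_equal. ring. }
      rewrite RtoC_inv, RtoC_mult by nra. unfold v, e.
      transitivity (/ (RtoC (Cmod b) * RtoC (Cmod a)) *
        (b * (RtoC (Cmod a) * RtoC (Cmod a)) / a))%C.
      - field. now repeat split.
      - rewrite <- Haa. field. now repeat split. }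
    rewrite Ev, re_scal_l. unfold chi in E1. fold b in E1.
    replace (Re (b * Cconj a)%C) with (cos (PI / INR k) * (Cmod b * Cmod a)) by lra.
    field. lra. }
  destruct (root_of_unity_of_Re v k Hk Hv Hre) as [Hv1 Hvk].
  replace (f 0%C) with (f (e * 0)%C) by (now rewrite Cmult_0_r).
  apply (sector_estimate (fun z => f (e * z)%C) v k
           (fun t => gamma (t1 * t)%R / e)%C (Cmod a) (Cmod b) delta);
    try assumption.
  - now apply differentiable_scale.
  - intros z Hz. apply Bf. now apply disk_rotation.
  - intros t Ht. assert (Htt : 0 <= t1 * t <= 1) by nra.
    destruct (Hgamma (t1 * t) Htt) as [H1 [H2 H3]]. repeat split.
    + unfold disk. rewrite Cmod_div, He by exact He0. unfold disk in H1. lra.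
    + apply continuous_Cmult; [|apply continuous_const].
      apply (continuous_comp (fun t => t1 * t) gamma); [|exact H2].
      apply (continuous_mult (K := R_AbsRing));
        [apply continuous_const|apply continuous_id].
    + replace (e * (gamma (t1 * t)%R / e))%C with (gamma (t1 * t)%R)
        by (field; exact He0). exact H3.
  - rewrite Rmult_0_r. fold a. unfold e. field. now split.
  - rewrite Rmult_1_r. fold b. unfold v. field. now split.
Qed.

(** * Automorphisms of the disk *)

Definition moebius (a x : C) : C := ((x - a) / (1 - Cconj a * x))%C.

Lemma moebius_denominator (a x : C) :
  disk a -> closed_disk x -> (1 - Cconj a * x)%C <> 0%C.
Proof.
  unfold disk, closed_disk. intros Ha Hx E.
  assert (H : (Cconj a * x)%C = 1%C).
  { transitivity (1 - (1 - Cconj a * x))%C; [ring|]. rewrite E. ring. }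
  apply (f_equal Cmod) in H. rewrite Cmod_mult, Cmod_conj, Cmod_1 in H.
  pose proof (Cmod_ge_0 a). pose proof (Cmod_ge_0 x). nra.
Qed.

Lemma moebius_identity (a x : C) :
  Cmod (1 - Cconj a * x) ^ 2 - Cmod (x - a) ^ 2
  = (1 - Cmod a ^ 2) * (1 - Cmod x ^ 2).
Proof.
  rewrite !Cmod2_alt. destruct a, x. simpl. ring.
Qed.

Lemma moebius_closed_disk (a x : C) :
  disk a -> closed_disk x -> closed_disk (moebius a x).
Proof.
  intros Ha Hx. pose proof (moebius_denominator a x Ha Hx) as Hd.
  unfold closed_disk, moebius. rewrite Cmod_div by exact Hd.
  apply Cmod_gt_0 in Hd. pose proof (moebius_identity a x) as E.
  unfold disk, closed_disk in Ha, Hx.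
  pose proof (Cmod_ge_0 a). pose proof (Cmod_ge_0 x). pose proof (Cmod_ge_0 (x - a)).
  assert (0 <= (1 - Cmod a ^ 2) * (1 - Cmod x ^ 2))
    by (apply Rmult_le_pos; simpl; nra).
  apply Rmult_le_reg_r with (Cmod (1 - Cconj a * x)); [exact Hd|].
  unfold Rdiv. rewrite Rmult_assoc, Rinv_l by lra. simpl in E. nra.
Qed.

Lemma moebius_disk (a x : C) : disk a -> disk x -> disk (moebius a x).
Proof.
  intros Ha Hx.
  assert (Hx' : closed_disk x) by (unfold disk, closed_disk in *; lra).
  pose proof (moebius_denominator a x Ha Hx') as Hd.
  unfold disk, moebius. rewrite Cmod_div by exact Hd.
  apply Cmod_gt_0 in Hd. pose proof (moebius_identity a x) as E.
  unfold disk in Ha, Hx.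
  pose proof (Cmod_ge_0 a). pose proof (Cmod_ge_0 x). pose proof (Cmod_ge_0 (x - a)).
  assert (0 < (1 - Cmod a ^ 2) * (1 - Cmod x ^ 2))
    by (apply Rmult_lt_0_compat; simpl; nra).
  apply Rmult_lt_reg_r with (Cmod (1 - Cconj a * x)); [exact Hd|].
  unfold Rdiv. rewrite Rmult_assoc, Rinv_l by lra. simpl in E. nra.
Qed.

Lemma disk_opp (a : C) : disk a -> disk (- a).
Proof. unfold disk. now rewrite Cmod_opp. Qed.

Lemma disk_closed_disk (x : C) : disk x -> closed_disk x.
Proof. unfold disk, closed_disk. lra. Qed.

Lemma moebius_inverse (a x : C) :
  disk a -> disk x -> moebius (- a) (moebius a x) = x.
Proof.
  intros Ha Hx.
  pose proof (moebius_denominator a x Ha (disk_closed_disk _ Hx)) as H1.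
  pose proof (moebius_denominator a a Ha (disk_closed_disk _ Ha)) as H2.
  unfold moebius in *. rewrite Copp_conj.
  field. split; [exact H1|].
  replace (1 - Cconj a * x - - Cconj a * (x - a))%C with (1 - Cconj a * a)%C by ring.
  exact H2.
Qed.

Lemma continuous_moebius (a x : C) :
  disk a -> closed_disk x -> continuous (moebius a) x.
Proof.
  intros Ha Hx. apply continuous_Cmult.
  - apply continuous_Cminus; [apply continuous_id|apply continuous_const].
  - apply continuous_Cinv; [|now apply moebius_denominator].
    apply continuous_Cminus; [apply continuous_const|].
    apply continuous_Cmult; [apply continuous_const|apply continuous_id].
Qed.

Lemma differentiable_moebius (f : C -> C) (a : C) :
  disk a -> differentiable_on_disk f ->
  differentiable_on_disk (fun x => f (moebius a x)).
Proof.
  intros Ha Hf x Hx. destruct (Hf _ (moebius_disk a x Ha Hx)) as [l Hl].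
  eexists. apply (cderiv_comp f (moebius a)); [exact Hl|].
  apply (cderiv_div (fun x => x - a)%C (fun x => 1 - Cconj a * x)%C).
  - apply (cderiv_minus (fun x => x) (fun _ => a));
      [apply cderiv_id|apply cderiv_const].
  - apply (cderiv_minus (fun _ => 1%C) (fun x => Cconj a * x)%C);
      [apply cderiv_const|].
    apply (cderiv_mult (fun _ => Cconj a) (fun x => x));
      [apply cderiv_const|apply cderiv_id].
  - apply moebius_denominator; [exact Ha|now apply disk_closed_disk].
Qed.

(** * A two-constants theorem for paths *)

(** The points [p] and [q], seen from [a], do not lie on one hyperbolic line
    through [a]. *)
Definition seen_at_angle (a p q : C) : Prop :=
  Im (moebius a q * Cconj (moebius a p))%C <> 0.

Lemma Re_lt_Cmod (z : C) : Im z <> 0 -> Re z < Cmod z.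
Proof.
  intros H. pose proof (Cmod2_alt z) as E. pose proof (Cmod_ge_0 z).
  pose proof (Rsqr_pos_lt _ H) as H1. unfold Rsqr in H1. simpl in E. nra.
Qed.

Lemma cos_near_1 (c : R) : c < 1 -> exists k, (1 <= k)%nat /\ c < cos (PI / INR k).
Proof.
  intros Hc.
  assert (Hcont : continuity_pt cos 0) by apply continuity_cos.
  destruct (Hcont (1 - c) ltac:(lra)) as [d [Hd H]].
  pose proof PI_RGT_0 as Hpi.
  destruct (nfloor_ex (PI / d)) as [n Hn].
  { apply Rlt_le, Rdiv_lt_0_compat; lra. }
  exists (S n). split; [lia|]. rewrite S_INR.
  pose proof (pos_INR n).
  assert (Hx : 0 < PI / (INR n + 1) < d).
  { split; [apply Rdiv_lt_0_compat; lra|].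
    apply Rmult_lt_reg_r with (INR n + 1); [lra|].
    unfold Rdiv. rewrite Rmult_assoc, Rinv_l by lra.
    destruct Hn as [_ Hn]. apply Rmult_lt_compat_r with (r := d) in Hn; [|lra].
    unfold Rdiv in Hn. rewrite Rmult_assoc, Rinv_l in Hn by lra. lra. }
  specialize (H (PI / (INR n + 1))). simpl in H. unfold R_dist, D_x, no_cond in H.
  rewrite cos_0, Rminus_0_r, Rabs_pos_eq in H by lra.
  specialize (H (conj (conj I (Rlt_not_eq _ _ (proj1 Hx))) (proj2 Hx))).
  apply Rabs_def2 in H. lra.
Qed.

(** An automorphism of the disk moves [a] to [0], and [k] is chosen so that all
    ends near [p] and [q] are seen from there at an angle of at least [PI / k].
    The estimate is uniform in [f] and in the path, which may run arbitrarily near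
    the circle. *)
Theorem two_constants (a p q : C) :
  disk a -> closed_disk p -> closed_disk q -> seen_at_angle a p q ->
  exists (k : nat) (r : R), (1 <= k)%nat /\ 0 < r /\
    forall (f : C -> C) (gamma : R -> C) (delta : R),
      differentiable_on_disk f -> bounded_by_1_on_disk f ->
      (forall t, 0 <= t <= 1 ->
         disk (gamma t) /\ continuous gamma t /\ Cmod (f (gamma t)) <= delta) ->
      Cmod (gamma 0 - p) < r -> Cmod (gamma 1 - q) < r ->
      Cmod (f a) ^ (2 * k) <= delta.
Proof.
  intros Ha Hp Hq Hangle. unfold seen_at_angle in Hangle.
  set (p' := moebius a p) in *. set (q' := moebius a q) in *.
  assert (Bp : Cmod p' <= 1) by now apply moebius_closed_disk.
  assert (Bq : Cmod q' <= 1) by now apply moebius_closed_disk.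
  pose proof (Re_lt_Cmod _ Hangle) as Hlt.
  rewrite Cmod_mult, Cmod_conj in Hlt.
  assert (Hpos : 0 < Cmod q' * Cmod p').
  { pose proof (Cmod_ge_0 q'). pose proof (Cmod_ge_0 p').
    destruct (Req_dec (Cmod q' * Cmod p') 0) as [E|N]; [|nra].
    rewrite <- (Cmod_conj p'), <- Cmod_mult in E. apply Cmod_eq_0 in E.
    elim Hangle. now rewrite E. }
  destruct (cos_near_1 (Re (q' * Cconj p')%C / (Cmod q' * Cmod p'))) as [k [Hk Hck]].
  { apply Rmult_lt_reg_r with (Cmod q' * Cmod p'); [exact Hpos|].
    unfold Rdiv. rewrite Rmult_assoc, Rinv_l by lra. lra. }
  set (c := cos (PI / INR k)) in *.
  assert (Hgap : 0 < c * (Cmod q' * Cmod p') - Re (q' * Cconj p')%C).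
  { apply Rmult_lt_compat_r with (r := Cmod q' * Cmod p') in Hck; [|exact Hpos].
    unfold Rdiv in Hck. rewrite Rmult_assoc, Rinv_l in Hck by lra. lra. }
  set (gap := c * (Cmod q' * Cmod p') - Re (q' * Cconj p')%C) in *.
  assert (He : 0 < gap / 4) by lra.
  destruct (proj1 (continuous_C_C _ _) (continuous_moebius a p Ha Hp) _ He)
    as [r1 [Hr1 Hp1]].
  destruct (proj1 (continuous_C_C _ _) (continuous_moebius a q Ha Hq) _ He)
    as [r2 [Hr2 Hq1]].
  exists k, (Rmin r1 r2). split; [exact Hk|]. split; [now apply Rmin_glb_lt|].
  intros f gamma delta Df Bf Hgamma H0 H1.
  pose proof (Rmin_l r1 r2). pose proof (Rmin_r r1 r2).
  specialize (Hp1 (gamma 0) ltac:(lra)). specialize (Hq1 (gamma 1) ltac:(lra)).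
  fold p' in Hp1. fold q' in Hq1.
  destruct (Hgamma 0 ltac:(lra)) as [D0 _]. destruct (Hgamma 1 ltac:(lra)) as [D1 _].
  pose proof (moebius_disk a _ Ha D0) as B0. pose proof (moebius_disk a _ Ha D1) as B1.
  unfold disk in B0, B1.
  assert (Ea : moebius (- a) 0 = a).
  { unfold moebius. rewrite Cmult_0_r. field. }
  rewrite <- Ea.
  apply (angle_estimate (fun x => f (moebius (- a) x)) k (fun t => moebius a (gamma t))).
  - apply differentiable_moebius; [now apply disk_opp|exact Df].
  - intros x Hx. apply Bf, moebius_disk; [now apply disk_opp|exact Hx].
  - exact Hk.
  - intros t Ht. destruct (Hgamma t Ht) as [G1 [G2 G3]]. repeat split.
    + now apply moebius_disk.
    + apply (continuous_comp gamma (moebius a)); [exact G2|].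
      apply continuous_moebius; [exact Ha|now apply disk_closed_disk].
    + now rewrite moebius_inverse.
  - fold c. set (x := moebius a (gamma 0)) in *. set (y := moebius a (gamma 1)) in *.
    pose proof (COS_bound (PI / INR k)) as Hc. fold c in Hc.
    assert (Hclose : Cmod (y * Cconj x - q' * Cconj p') <= gap / 2).
    { replace (y * Cconj x - q' * Cconj p')%C
        with ((y - q') * Cconj x + q' * Cconj (x - p'))%C
        by (rewrite Cminus_conj; ring).
      apply Rle_trans with (1 := Cmod_triangle _ _).
      rewrite !Cmod_mult, !Cmod_conj.
      pose proof (Cmod_ge_0 x). pose proof (Cmod_ge_0 q').
      pose proof (Cmod_ge_0 (y - q')). pose proof (Cmod_ge_0 (x - p')). nra. }
    assert (HR : Re (y * Cconj x)%C - Re (q' * Cconj p')%C <= gap / 2).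
    { apply Rle_trans with (2 := Hclose). apply Rle_trans with (2 := re_le_Cmod _).
      apply Rle_trans with (2 := Rle_abs _). unfold Cminus.
      rewrite re_plus, re_opp. lra. }
    assert (HM : Rabs (Cmod y * Cmod x - Cmod q' * Cmod p') <= gap / 2).
    { replace (Cmod y * Cmod x) with (Cmod (y * Cconj x))
        by now rewrite Cmod_mult, Cmod_conj.
      replace (Cmod q' * Cmod p') with (Cmod (q' * Cconj p'))
        by now rewrite Cmod_mult, Cmod_conj.
      pose proof (Cmod_reverse_triangle (y * Cconj x) (q' * Cconj p')) as T1.
      pose proof (Cmod_reverse_triangle (q' * Cconj p') (y * Cconj x)) as T2.
      rewrite (Cmod_minus_sym (q' * Cconj p')) in T2. apply Rabs_le. lra. }
    apply Rabs_le_between in HM. unfold gap in *. nra.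
Qed.

(** The exceptional points [a] form the hyperbolic line through [p] and [q], with
    equation [L a = 0]; first and second differences show that it contains no
    ball, since vanishing of [alpha] and [v] would force [p = q]. *)
Lemma seen_at_angle_dense (b p q : C) (r : R) :
  disk b -> closed_disk p -> closed_disk q -> p <> q -> 0 < r ->
  exists a, disk a /\ Cmod (a - b) < r /\ seen_at_angle a p q.
Proof.
  intros Hb Hp Hq Hpq Hr.
  set (alpha := Im (p * Cconj q)%C).
  set (v := (RtoC (1 + Cmod p ^ 2) * q - RtoC (1 + Cmod q ^ 2) * p)%C).
  set (L := fun a : C => alpha * (1 + Cmod a ^ 2) + Im (v * Cconj a)%C).
  assert (Hline : forall a, disk a -> L a <> 0 -> seen_at_angle a p q).
  { intros a Ha HL E. apply HL.
    pose proof (moebius_denominator a p Ha Hp) as Np.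
    pose proof (moebius_denominator a q Ha Hq) as Nq.
    assert (EL : (moebius a q * Cconj (moebius a p) *
        RtoC (Cmod (1 - Cconj a * q) ^ 2 * Cmod (1 - Cconj a * p) ^ 2))%C
      = ((q - a) * Cconj (1 - Cconj a * q) * Cconj ((p - a) * Cconj (1 - Cconj a * p)))%C).
    { rewrite RtoC_mult, !Cmod2_conj. unfold moebius.
      rewrite Cdiv_conj, Cmult_conj, Cconj_conj by exact Np.
      field. split; [|exact Nq].
      intros E'. apply Np. rewrite <- (Cconj_conj (1 - Cconj a * p)), E'.
      unfold Cconj, RtoC; simpl. f_equal. ring. }
    apply (f_equal Im) in EL. rewrite im_scal_r, E, Rmult_0_l in EL.
    assert (EL2 : Im ((q - a) * Cconj (1 - Cconj a * q)
                      * Cconj ((p - a) * Cconj (1 - Cconj a * p)))%C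
                  = - (1 - Cmod a ^ 2) * L a).
    { unfold L, v, alpha.
      unfold Cminus. rewrite !RtoC_plus.
      rewrite !Cmod2_alt. destruct a, p, q. simpl. ring. }
    rewrite EL2 in EL. unfold disk in Ha. pose proof (Cmod_ge_0 a).
    assert (1 - Cmod a ^ 2 <> 0) by (simpl; nra). symmetry in EL.
    apply Rmult_integral in EL. destruct EL; [lra|assumption]. }
  unfold disk in Hb.
  set (h := Rmin (r / 2) ((1 - Cmod b) / 2)).
  assert (Hh : 0 < h) by (apply Rmin_glb_lt; lra).
  assert (Hh1 : h <= r / 2) by apply Rmin_l.
  assert (Hh2 : h <= (1 - Cmod b) / 2) by apply Rmin_r.
  assert (Hnear : forall e : C, Cmod e <= 1 -> disk (b + RtoC h * e) /\
            Cmod (b + RtoC h * e - b) < r).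
  { intros e He.
    assert (Hm : Cmod (RtoC h * e) <= h).
    { rewrite Cmod_mult, Cmod_R, Rabs_pos_eq by lra. pose proof (Cmod_ge_0 e). nra. }
    split.
    - unfold disk. pose proof (Cmod_triangle b (RtoC h * e)). lra.
    - replace (b + RtoC h * e - b)%C with (RtoC h * e)%C by ring. lra. }
  apply NNPP. intros Hno.
  assert (HL0 : forall e : C, Cmod e <= 1 -> L (b + RtoC h * e)%C = 0).
  { intros e He. apply NNPP. intros HN. apply Hno.
    exists (b + RtoC h * e)%C. destruct (Hnear e He) as [H1 H2].
    split; [exact H1|]. split; [exact H2|]. now apply Hline. }
  assert (Ci1 : Cmod Ci <= 1).
  { pose proof (Cmod2_alt Ci) as E. simpl in E. pose proof (Cmod_ge_0 Ci). nra. }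
  pose proof (HL0 0%C ltac:(rewrite Cmod_0; lra)) as E0.
  pose proof (HL0 1%C ltac:(rewrite Cmod_1; lra)) as E1.
  pose proof (HL0 (- (1))%C ltac:(rewrite Cmod_opp, Cmod_1; lra)) as E2.
  pose proof (HL0 Ci Ci1) as E3.
  unfold closed_disk in Hp, Hq.
  pose proof (Cmod_ge_0 p) as Pp. pose proof (Cmod_ge_0 q) as Pq.
  pose proof (Cmod2_alt p) as Mp. pose proof (Cmod2_alt q) as Mq.
  unfold L in E0, E1, E2, E3. rewrite !Cmod2_alt in E0, E1, E2, E3.
  assert (V : v = 0%C).
  { destruct v as [v1 v2], b as [x y]. simpl in E0, E1, E2, E3.
    assert (A0 : alpha = 0).
    { assert (A : 2 * alpha * (h * h) = 0) by lra.
      apply Rmult_integral in A. destruct A; [lra|nra]. }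
    rewrite A0 in *. unfold RtoC. f_equal.
    - assert (A : v1 * h = 0) by lra. apply Rmult_integral in A. lra.
    - assert (A : v2 * h = 0) by lra. apply Rmult_integral in A. lra. }
  unfold v in V.
  set (s := 1 + Cmod p ^ 2) in *. set (t := 1 + Cmod q ^ 2) in *.
  assert (Hs : 1 <= s <= 2) by (unfold s; simpl; nra).
  assert (Ht : 1 <= t <= 2) by (unfold t; simpl; nra).
  apply Ceq_minus in V.
  assert (Em : s * Cmod q = t * Cmod p).
  { apply (f_equal Cmod) in V. rewrite !Cmod_mult, !Cmod_R, !Rabs_pos_eq in V by lra.
    exact V. }
  (* The map [x |-> x / (1 + x ^ 2)] is injective on [0, 1]. *)
  assert (Est : s = t).
  { assert (Eq : Cmod q * Cmod q = t - 1) by (unfold t; ring).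
    assert (Ep : Cmod p * Cmod p = s - 1) by (unfold s; ring).
    assert (X : (s * Cmod q) * (s * Cmod q) = (t * Cmod p) * (t * Cmod p))
      by now rewrite Em.
    assert (F : (s - t) * ((s - 1) * (t - 1) - 1) = 0).
    { replace ((s - t) * ((s - 1) * (t - 1) - 1))
        with (s * s * (t - 1) - t * t * (s - 1)) by ring.
      rewrite <- Eq, <- Ep. lra. }
    apply Rmult_integral in F. destruct F as [F|F]; [lra|].
    assert (2 <= s) by nra. assert (2 <= t) by nra. lra. }
  apply Hpq. rewrite <- Est in V.
  assert (Hs0 : RtoC s <> 0%C) by (apply RtoC_neq_0; lra).
  transitivity (/ RtoC s * (RtoC s * p))%C; [field; exact Hs0|].
  rewrite <- V. field. exact Hs0.
Qed.

(** * Cluster points *)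

Definition shrinking_family {X : Type} (B : R -> X -> Prop) : Prop :=
  (forall d, 0 < d -> exists x, B d x) /\
  (forall d e x, d <= e -> B d x -> B e x).

(** The cluster point is an upper limit.  Passing to a smaller family with the
    same properties replaces the extraction of a subsequence and can be
    iterated. *)
Lemma cluster_point_R (X : Type) (B : R -> X -> Prop) (f : X -> R) (M : R) :
  shrinking_family B -> (forall d x, B d x -> Rabs (f x) <= M) ->
  exists c, shrinking_family (fun d x => B d x /\ Rabs (f x - c) < d).
Proof.
  intros [Hne Hmono] HM.
  set (E := fun y => forall d, 0 < d -> exists x, B d x /\ y <= f x).
  destruct (completeness E) as [c [Hc1 Hc2]].
  - exists M. intros y Hy. destruct (Hy 1 Rlt_0_1) as [x [Hx Hyx]].
    apply Rle_trans with (1 := Hyx). apply Rle_trans with (1 := Rle_abs _).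
    exact (HM _ _ Hx).
  - exists (- M). intros d Hd. destruct (Hne d Hd) as [x Hx]. exists x.
    split; [exact Hx|]. pose proof (HM _ _ Hx) as H.
    apply Rabs_le_between in H. lra.
  - exists c. split.
    + intros d Hd.
      assert (Hup : ~ E (c + d / 2)).
      { intros H. pose proof (Hc1 _ H). lra. }
      assert (Hup' : exists d', 0 < d' /\ forall x, B d' x -> f x < c + d / 2).
      { apply NNPP. intros N. apply Hup. intros d' Hd'. apply NNPP. intros N'.
        apply N. exists d'. split; [exact Hd'|]. intros x Hx.
        apply Rnot_le_lt. intros H. apply N'. now exists x. }
      destruct Hup' as [d' [Hd' Hlt]].
      assert (Hlow : exists y, E y /\ c - d < y).
      { apply NNPP. intros N. assert (c <= c - d); [|lra].
        apply Hc2. intros y Hy. apply Rnot_lt_le. intros H. apply N.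
        now exists y. }
      destruct Hlow as [y [Hy Hcy]].
      destruct (Hy (Rmin d d')) as [x [Hx Hyx]]; [now apply Rmin_glb_lt|].
      exists x. split; [apply Hmono with (2 := Hx); apply Rmin_l|].
      pose proof (Hlt x (Hmono _ _ _ (Rmin_r d d') Hx)). apply Rabs_def1; lra.
    + intros d e x Hde [Hx Hf]. split; [now apply Hmono with d|lra].
Qed.

Lemma cluster_point_C (X : Type) (B : R -> X -> Prop) (f : X -> C) (M : R) :
  shrinking_family B -> (forall d x, B d x -> Cmod (f x) <= M) ->
  exists c, shrinking_family (fun d x => B d x /\ Cmod (f x - c) < d).
Proof.
  intros HB HM.
  destruct (cluster_point_R X B (fun x => Re (f x)) M HB) as [c1 H1].
  { intros d x Hx. apply Rle_trans with (1 := re_le_Cmod _). exact (HM _ _ Hx). }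
  destruct (cluster_point_R X _ (fun x => Im (f x)) M H1) as [c2 [H2 _]].
  { intros d x [Hx _]. apply Rle_trans with (1 := im_le_Cmod _). exact (HM _ _ Hx). }
  exists (c1, c2). split.
  - intros d Hd. destruct (H2 (d / 2)) as [x [[Hx Hre] Him]]; [lra|].
    exists x. split; [apply (proj2 HB) with (2 := Hx); lra|].
    apply Rle_lt_trans with (1 := Cmod_le_re_im _).
    destruct (f x) as [u v]. simpl in *. unfold Rminus in *. lra.
  - intros d e x Hde [Hx Hf]. split; [now apply (proj2 HB) with d|lra].
Qed.

(** * Continuity of the evolution family *)

Lemma continuous_on_C_norm (U : UniformSpace) (D : U -> Prop) (f : U -> C) (x : U)
    (eps : R) :
  continuous_on D f -> D x -> 0 < eps ->
  within D (locally x) (fun y => Cmod (f y - f x) < eps).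
Proof.
  intros Hf Hx Heps.
  generalize (proj1 (filterlim_locally_ball_norm (U := C_R_NormedModule) f (f x))
                (Hf x Hx) (mkposreal eps Heps)).
  apply filter_imp. intros y Hy. rewrite Cmod_norm. exact Hy.
Qed.

Lemma continuous_on_R_C (D : R -> Prop) (f : R -> C) (t : R) (eps : R) :
  continuous_on D f -> D t -> 0 < eps ->
  exists d, 0 < d /\ forall u, Rabs (u - t) < d -> D u -> Cmod (f u - f t) < eps.
Proof.
  intros Hf Ht Heps.
  destruct (continuous_on_C_norm R_UniformSpace D f t eps Hf Ht Heps) as [d Hd].
  exists d. split; [apply cond_pos|]. intros u Hu Du. now apply Hd.
Qed.

Lemma closed_disk_limit (x : C) :
  (forall d, 0 < d -> exists y, disk y /\ Cmod (y - x) < d) -> closed_disk x.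
Proof.
  intros H. unfold closed_disk. apply le_epsilon. intros e He.
  destruct (H e He) as [y [Hy Hyx]]. unfold disk in Hy.
  pose proof (Cmod_reverse_triangle x y). rewrite Cmod_minus_sym in Hyx. lra.
Qed.

Lemma disk_algebra_limit (f : C -> C) (x : C) :
  disk_algebra f -> closed_disk x ->
  exists c, forall eps, 0 < eps -> exists d, 0 < d /\
    forall z, disk z -> Cmod (z - x) < d -> Cmod (f z - c) < eps.
Proof.
  intros [_ [g [Cg Eg]]] Hx. exists (g x). intros eps Heps.
  pose proof (continuous_on_C_norm C_UniformSpace closed_disk g x eps Cg Hx Heps) as H.
  apply locally_C_norm in H. destruct H as [d [Hd H]].
  exists d. split; [exact Hd|]. intros z Hz Hzx. rewrite <- Eg by exact Hz.
  apply H; [exact Hzx|]. now apply disk_closed_disk.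
Qed.

Lemma disk_norm_le (f : C -> C) (M : R) :
  (forall z, disk z -> Cmod (f z) <= M) -> Rbar_le (disk_norm f) M.
Proof.
  intros H. apply (proj2 (Lub_Rbar_correct _)).
  intros r [z [Hz ->]]. now apply H.
Qed.

Lemma holomorphic_differentiable (f : C -> C) :
  holomorphic_on_disk f -> differentiable_on_disk f.
Proof.
  intros Hf z Hz. destruct (Hf z Hz) as [l Hl]. exists l.
  now apply cderiv_of_is_derive.
Qed.

Theorem proposition6p3
  (phi : R -> R -> C -> C)
  (phi_holo : forall s t : R, 0 <= s -> s <= t ->
     holomorphic_on_disk (phi s t))
  (phi_self : forall s t : R, 0 <= s -> s <= t ->
     forall z : C, disk z -> disk (phi s t z))
  (phi_id : forall s : R, 0 <= s -> forall z : C, disk z -> phi s s z = z)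
  (phi_comp : forall s u t : R, 0 <= s -> s <= u -> u <= t ->
     forall z : C, disk z -> phi s t z = phi u t (phi s u z))
  (phi_A : forall s t : R, 0 <= s -> s <= t -> disk_algebra (phi s t))
  (phi_cont_t : forall z : C, disk z -> forall s : R, 0 <= s ->
     continuous_on (fun t : R => s <= t) (fun t : R => phi s t z))
  (phi_cont_s : forall z : C, disk z -> forall t : R, 0 <= t ->
     continuous_on (fun s : R => 0 <= s <= t) (fun s : R => phi s t z))
  (phi_nonconst : forall s t : R, 0 <= s -> s <= t ->
     ~ constant_on_disk (phi s t))
  (s : R) (hs : 0 <= s) :
  continuous_on_to_disk_algebra (fun t : R => s <= t) (fun t : R => phi s t).
Proof.
  split; [intros t Ht; now apply phi_A|].
  intros t0 Ht0 eps. pose proof (cond_pos eps) as Heps.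
  (* The pairs [(t, z)] with [t] near [t0] that witness a large norm. *)
  set (B := fun (d : R) (x : R * C) => Rabs (fst x - t0) < d /\ s <= fst x /\
     disk (snd x) /\
     eps / 2 < Cmod (phi s (fst x) (snd x) - phi s t0 (snd x))).
  destruct (classic (exists d, 0 < d /\ forall x, ~ B d x)) as [[d [Hd Hno]]|Hyes].
  { exists (mkposreal d Hd). intros t Ht Hst.
    apply Rbar_le_lt_trans with (Finite (eps / 2)); [|simpl; lra].
    apply disk_norm_le. intros z Hz. apply Rnot_lt_le. intros H.
    apply (Hno (t, z)). now repeat split. }
  exfalso.
  assert (HB : shrinking_family B).
  { split.
    - intros d Hd. apply NNPP. intros N. apply Hyes. exists d. split; [exact Hd|].
      intros x Hx. apply N. now exists x.
    - intros d e x Hde [H1 H2]. split; [lra|exact H2]. }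
  destruct (cluster_point_C _ B snd 1 HB) as [sigma HB1].
  { intros d x [_ [_ [H _]]]. unfold disk in H. lra. }
  destruct (cluster_point_C _ _ (fun x => phi s (fst x) (snd x)) 1 HB1) as [q HB2].
  { intros d x [[_ [H1 [H2 _]]] _].
    pose proof (phi_self s (fst x) hs H1 (snd x) H2) as H. unfold disk in H. lra. }
  destruct HB2 as [HB2 _]. clear HB HB1 Hyes.
  assert (Hsigma : closed_disk sigma).
  { apply closed_disk_limit. intros d Hd. destruct (HB2 d Hd) as [x [[H1 H2] _]].
    exists (snd x). split; [apply H1|exact H2]. }
  assert (Hq : closed_disk q).
  { apply closed_disk_limit. intros d Hd. destruct (HB2 d Hd) as [x [[H1 _] H2]].
    exists (phi s (fst x) (snd x)). split; [|exact H2]. apply phi_self; trivial; apply H1. }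
  (* A time after [t0], so that [t <= T] for all [t] near [t0]. *)
  set (T := t0 + 1).
  assert (HsT : s <= T) by (unfold T; lra).
  destruct (disk_algebra_limit _ sigma (phi_A s t0 hs Ht0) Hsigma) as [p Hp].
  destruct (disk_algebra_limit _ sigma (phi_A s T hs HsT) Hsigma) as [c Hc].
  assert (Happroach : forall d, 0 < d -> exists z, disk z /\ Cmod (z - sigma) < d).
  { intros d Hd. destruct (HB2 d Hd) as [x [[H1 H2] _]]. exists (snd x).
    split; [apply H1|exact H2]. }
  assert (Hlim : forall t w, s <= t -> (forall e, 0 < e -> exists d, 0 < d /\
    forall z, disk z -> Cmod (z - sigma) < d -> Cmod (phi s t z - w) < e) ->
    closed_disk w).
  { intros t w Ht Hw. apply closed_disk_limit. intros e He.
    destruct (Hw e He) as [d [Hd H]]. destruct (Happroach d Hd) as [z [Hz Hzs]].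
    exists (phi s t z). split; [now apply phi_self|now apply H]. }
  assert (Hpc : closed_disk p) by now apply (Hlim t0).
  assert (Hcc : closed_disk c) by now apply (Hlim T).
  assert (Hpq : p <> q).
  { intros E. destruct (Hp (eps / 4)) as [d [Hd Hpd]]; [lra|].
    destruct (HB2 (Rmin d (eps / 4))) as [x [[[_ [H1 [H2 H3]]] H4] H5]].
    { apply Rmin_glb_lt; lra. }
    pose proof (Rmin_l d (eps / 4)). pose proof (Rmin_r d (eps / 4)).
    pose proof (Hpd (snd x) H2 ltac:(lra)) as H6.
    rewrite <- E in H5. rewrite Cmod_minus_sym in H6.
    pose proof (Cmod_triangle (phi s (fst x) (snd x) - p) (p - phi s t0 (snd x))) as H7.
    replace (phi s (fst x) (snd x) - p + (p - phi s t0 (snd x)))%C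
      with (phi s (fst x) (snd x) - phi s t0 (snd x))%C in H7 by ring.
    lra. }
  assert (H0t0 : 0 <= t0) by lra.
  assert (Ht0T : t0 <= T) by (unfold T; lra).
  assert (Hb : exists b, disk b /\ phi t0 T b <> c).
  { apply NNPP. intros N. apply (phi_nonconst t0 T H0t0 Ht0T). exists c.
    intros z Hz. apply NNPP. intros N'. apply N. now exists z. }
  destruct Hb as [b [Hb Hbc]].
  assert (Hbc' : 0 < Cmod (phi t0 T b - c)).
  { apply Cmod_gt_0. now apply Cminus_eq_contra. }
  destruct (proj1 (continuous_C_C _ _)
    (differentiable_continuous _ b
      (holomorphic_differentiable _ (phi_holo t0 T H0t0 Ht0T)) Hb) _ Hbc')
    as [r [Hr Hbr]].
  destruct (seen_at_angle_dense b p q r Hb Hpc Hq Hpq Hr) as [a [Ha [Hab Hangle]]].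
  set (kappa := Cmod (phi t0 T a - c)).
  assert (Hkappa : 0 < kappa).
  { pose proof (Hbr a Hab) as H. unfold kappa.
    pose proof (Cmod_triangle (phi t0 T b - phi t0 T a) (phi t0 T a - c)) as H'.
    replace (phi t0 T b - phi t0 T a + (phi t0 T a - c))%C
      with (phi t0 T b - c)%C in H' by ring.
    rewrite (Cmod_minus_sym (phi t0 T b) (phi t0 T a)) in H'. lra. }
  destruct (two_constants a p q Ha Hpc Hq Hangle) as [k [rho [Hk [Hrho Htwo]]]].
  (* At [a] the function [f] below will have modulus at least [kappa / 4]. *)
  set (delta := (kappa / 4) ^ (2 * k)).
  assert (Hdelta : 0 < delta) by (apply pow_lt; lra).
  destruct (Hc delta Hdelta) as [d1 [Hd1 Hc1]].
  destruct (Hp (rho / 2)) as [d2 [Hd2 Hp2]]; [lra|].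
  (* The base point [y] of the segments is chosen before the time [t], so that
     pointwise continuity applies at it. *)
  destruct (Happroach (Rmin d1 d2)) as [y [Hy Hys]]; [now apply Rmin_glb_lt|].
  pose proof (Rmin_l d1 d2). pose proof (Rmin_r d1 d2).
  destruct (continuous_on_R_C _ _ t0 (rho / 2) (phi_cont_t y Hy s hs) Ht0 ltac:(lra))
    as [d3 [Hd3 Hy3]].
  destruct (continuous_on_R_C _ _ t0 (kappa / 2)
    (phi_cont_s a Ha T ltac:(lra)) (conj H0t0 Ht0T) ltac:(lra)) as [d4 [Hd4 Ha4]].
  set (d := Rmin (Rmin d1 rho) (Rmin (Rmin d3 d4) 1)).
  assert (Hd : 0 < d) by (repeat apply Rmin_glb_lt; lra).
  assert (L : d <= d1 /\ d <= rho /\ d <= d3 /\ d <= d4 /\ d <= 1).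
  { pose proof (Rmin_l (Rmin d1 rho) (Rmin (Rmin d3 d4) 1)).
    pose proof (Rmin_r (Rmin d1 rho) (Rmin (Rmin d3 d4) 1)). fold d in H1, H2.
    pose proof (Rmin_l d1 rho). pose proof (Rmin_r d1 rho).
    pose proof (Rmin_l (Rmin d3 d4) 1). pose proof (Rmin_r (Rmin d3 d4) 1).
    pose proof (Rmin_l d3 d4). pose proof (Rmin_r d3 d4). lra. }
  destruct (HB2 d Hd) as [[t z] [[[Htt [Hst [Hz _]]] Hzs] Hzq]]. simpl in *.
  apply Rabs_def2 in Htt as Htt'.
  assert (HtT : t <= T) by (unfold T; lra).
  assert (H0t : 0 <= t) by lra.
  set (f := fun w => ((phi t T w - c) * / 2)%C).
  assert (Cmod2 : Cmod (/ 2) = / 2).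
  { rewrite <- RtoC_half, Cmod_R, Rabs_pos_eq; lra. }
  unfold closed_disk in Hcc.
  assert (Hfa : Cmod (f a) ^ (2 * k) <= delta / 2).
  { apply (Htwo f (fun u => phi s t (seg y z u))).
    - intros w Hw.
      destruct (holomorphic_differentiable _ (phi_holo t T H0t HtT) w Hw) as [l Hl].
      eexists. apply (cderiv_mult (fun w => phi t T w - c)%C (fun _ => / 2)%C);
        [|apply cderiv_const].
      apply (cderiv_minus (phi t T) (fun _ => c)); [exact Hl|apply cderiv_const].
    - intros w Hw. unfold f. rewrite Cmod_mult, Cmod2.
      pose proof (Cmod_triangle_minus (phi t T w) c).
      pose proof (phi_self t T H0t HtT w Hw) as Hself. unfold disk in Hself. lra.
    - intros u Hu. assert (Hseg : disk (seg y z u)) by now apply seg_in_disk.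
      split; [now apply phi_self|]. split.
      + apply (continuous_comp (seg y z) (phi s t)); [apply continuous_seg|].
        apply differentiable_continuous; [|exact Hseg].
        now apply holomorphic_differentiable, phi_holo.
      + unfold f. rewrite <- phi_comp by trivial. rewrite Cmod_mult, Cmod2.
        assert (Cmod (phi s T (seg y z u) - c) < delta); [|lra].
        apply Hc1; [exact Hseg|].
        replace (seg y z u - sigma)%C with (seg (y - sigma) (z - sigma) u)
          by (unfold seg; ring).
        apply seg_in_ball; try exact Hu; lra.
    - rewrite seg_0.
      replace (phi s t y - p)%C
        with ((phi s t y - phi s t0 y) + (phi s t0 y - p))%C by ring.
      pose proof (Cmod_triangle (phi s t y - phi s t0 y) (phi s t0 y - p)).
      pose proof (Hy3 t ltac:(lra) Hst). pose proof (Hp2 y Hy ltac:(lra)). lra.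
    - rewrite seg_1. lra. }
  assert (Hfa2 : kappa / 4 <= Cmod (f a)).
  { unfold f. rewrite Cmod_mult, Cmod2.
    pose proof (Ha4 t ltac:(lra) (conj H0t HtT)) as H4.
    pose proof (Cmod_triangle (phi t0 T a - phi t T a) (phi t T a - c)) as H5.
    replace (phi t0 T a - phi t T a + (phi t T a - c))%C
      with (phi t0 T a - c)%C in H5 by ring.
    rewrite (Cmod_minus_sym (phi t0 T a) (phi t T a)) in H5. fold kappa in H5. lra. }
  assert (delta <= Cmod (f a) ^ (2 * k)) by (apply pow_incr; lra).
  lra.
Qed.
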